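(* Let $G$ be an algebraic group with a split $BN$-pair $(B,N)$, with $T=B\cap N$, $B=T\ltimes U$, $W=N/T$, and let $k$ be any field. Let $\theta$ be a one-dimensional representation of $T$ over $k$, and let $k_\theta$ be the corresponding one-dimensional $kT$-module, regarded also as a $kB$-module through $B\to T$. Let $M(\theta)=kG\otimes_{kB}k_\theta$, and let $\mathrm{St}=kU\sum_{w\in W}(-1)^{l(w)}w1_{tr}$ be the Steinberg module of $G$ over $k$. Then the $kG$-module $M(\theta)\otimes_k\mathrm{St}$ (with diagonal $G$-action) is isomorphic to $\mathrm{Ind}_T^Gk_\theta=kG\otimes_{kT}k_\theta$.
   Context: An algebraic group $G$ with a split $BN$-pair has closed subgroups $B$ and $N$ such that: (i) $B\cup N$ generates $G$, $T=B\cap N$ is normal in $N$, and all elements of $T$ are semisimple; (ii) $W=N/T$ is generated by a set $S$ of elements $s_i$ ($i\in I$) of order 2; (iii) if $n_i\in N$ maps to $s_i$ then $n_iBn_i\neq B$; (iv) for each $n\in N$ and each $n_i$, $n_iBn\subseteq Bn_inB\cup BnB$; (v) $B$ has a closed normal unipotent subgroup $U$ with $B=T\ltimes U$; (vi) $\bigcap_{n\in N}nBn^{-1}=T$. It is known that $W$ is a Weyl group (in particular a finite Coxeter group with simple reflections $S$); $l$ is its length function. $M(tr)=kG\otimes_{kB}k_{tr}$ is the module induced from the trivial one-dimensional $kB$-module $k_{tr}$ with nonzero element $1_{tr}$; for $w\in W$, $w1_{tr}:=n\otimes 1_{tr}$ for any $n\in N$ with image $w$ (well defined). It is known that $kU\sum_{w\in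 W}(-1)^{l(w)}w1_{tr}$ is a $kG$-submodule of $M(tr)$; this is $\mathrm{St}$. *)

(* Defs.v *)
From HB Require Import structures.
From mathcomp Require Import all_boot all_order all_algebra.
From mathcomp Require Import generic_quotient.
From mathcomp Require Import boolp classical_sets functions cardinality fsbigop.
From mathcomp Require Import freeg mpoly.

Set Implicit Arguments.
Unset Strict Implicit.
Unset Printing Implicit Defensive.

Import GRing.Theory.

Local Open Scope classical_set_scope.
Local Open Scope ring_scope.
Local Open Scope quotient_scope.

Section Groups.
Variable gT : groupType.
Implicit Types (A B H N T U X : set gT) (g h : gT).

Definition is_subgroup H : Prop :=
  [/\ H 1%g, forall g h, H g -> H h -> H (g * h)%g
    & forall g, H g -> H (g^-1)%g].

Definition set_mul A B : set gT := [set (a * b)%g | a in A & b in B].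

Definition conj_by g A : set gT := [set (g * a * g^-1)%g | a in A].

Definition is_normal H X : Prop :=
  [/\ is_subgroup H, H `<=` X & forall x, X x -> conj_by x H = H].

Definition semidirect X T U : Prop :=
  [/\ is_subgroup T, is_normal U X, T `&` U = [set 1%g] & set_mul T U = X].

Definition lcoset g T : set gT := [set (g * t)%g | t in T].

(* The underlying set of N / T; for T normal in N, the group law of N / T is
   set_mul and its unit is T. *)
Definition cosets N T : set (set gT) := [set lcoset n T | n in N].

Definition coset_word T (S : set (set gT)) (w : set gT) (m : nat) : Prop :=
  exists ws : seq (set gT),
    [/\ size ws = m, forall s, s \in ws -> S s & foldr set_mul T ws = w].

(* The length function of (N / T, S); the value 0 outside the span of S is a
   dummy one. *)
Definition coset_length T (S : set (set gT)) (w : set gT) : nat :=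
  if pselect (exists m, `[< coset_word T S w m >]) is left ex
  then ex_minn ex else 0%N.

End Groups.

(* Zariski closed subsets of GL_n: a regular function on GL_n is a polynomial
   in the entries divided by a power of the determinant, so zero loci of
   polynomials in the n * n entries suffice. *)
Definition GL_closed (K : fieldType) n (X : set 'M[K]_n) : Prop :=
  exists I : set {mpoly K[n * n]},
    X = [set A | A \in unitmx /\
                 forall p, I p -> p.@[fun i => mxvec A 0 i] = 0].

(* An (affine) algebraic group over an algebraically closed field K, given
   as a group with a closed embedding into some GL_n(K). *)
Record alg_group (K : closedFieldType) := AlgGroup {
  ag_dim : nat;
  ag_sort :> groupType;
  ag_mx : ag_sort -> 'M[K]_ag_dim;
  ag_mx1 : ag_mx 1%g = 1%:M;
  ag_mxM : forall g h : ag_sort, ag_mx (g * h)%g = ag_mx g *m ag_mx h;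
  ag_mx_inj : injective ag_mx;
  ag_mx_closed : GL_closed (range ag_mx) }.

Section BNPairs.
Variables (K : closedFieldType) (G : alg_group K).
Implicit Types (B N U H : set G) (S : set (set G)) (g : G).

Definition ag_closed (X : set G) : Prop := GL_closed (@ag_mx K G @` X).

Definition closed_subgroup H : Prop := is_subgroup H /\ ag_closed H.

Definition semisimple g : Prop := diagonalizable (ag_mx g).

Definition unipotent g : Prop :=
  exists m : nat, (ag_mx g - 1%:M : 'M[K]_(ag_dim G)) ^+ m = 0.

(* The elements of S are cosets of T = B `&` N, so that "s n" says that n is
   an element of N with image s in W = N / T.  As the elements of S have order
   2, S generates W when every element of W is a product of elements of S. *)
Record split_BN_pair B N U S : Prop := SplitBNPair {
  bn_B : closed_subgroup B;
  bn_N : closed_subgroup N;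
  bn_gen : smallest (@is_subgroup G) (B `|` N) = setT;
  bn_T_normal : is_normal (B `&` N) N;
  bn_T_semisimple : forall t, (B `&` N) t -> semisimple t;
  bn_S_sub : S `<=` cosets N (B `&` N);
  bn_S_order2 : forall s, S s -> s <> B `&` N /\ set_mul s s = B `&` N;
  bn_S_gen : forall w, cosets N (B `&` N) w ->
    exists m, coset_word (B `&` N) S w m;
  bn_neq : forall s n, S s -> s n -> [set (n * b * n)%g | b in B] <> B;
  bn_cell : forall s ni n, S s -> s ni -> N n ->
    [set (ni * b * n)%g | b in B] `<=`
      set_mul (set_mul B [set (ni * n)%g]) B `|`
      set_mul (set_mul B [set n]) B;
  bn_U : closed_subgroup U;
  bn_U_unipotent : forall u, U u -> unipotent u;
  bn_B_semidirect : semidirect B (B `&` N) U;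
  bn_bigcap : \bigcap_(n in N) conj_by n B = B `&` N }.

End BNPairs.

Section Span.
Variables (k : fieldType) (V : lmodType k).
Implicit Type X : set V.

Definition is_submod X : Prop :=
  X 0 /\ forall (a : k) u v, X u -> X v -> X (a *: u + v).

Definition lspan X : set V := smallest is_submod X.

Lemma lspan_is_submod X : is_submod (lspan X).
Proof.
split=> [Y [[Y0 _] _] //|a u v Xu Xv Y YX].
by case: (YX) => -[_ YZ] _; apply: YZ; [exact: Xu|exact: Xv].
Qed.

Definition in_lspan X : {pred V} := fun v => `[< lspan X v >].

Lemma in_lspanP X v : reflect (lspan X v) (v \in in_lspan X).
Proof. exact: asboolP. Qed.

Lemma in_lspan_submod X : submod_closed (in_lspan X).
Proof.
have [X0 XZ] := lspan_is_submod X.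
by split=> [|a u v /in_lspanP Xu /in_lspanP Xv]; apply/in_lspanP=> //; exact: XZ.
Qed.

HB.instance Definition _ X :=
  GRing.isSubmodClosed.Build k V (in_lspan X) (in_lspan_submod X).

Definition span_type X := {v : V | v \in in_lspan X}.

HB.instance Definition _ X := SubChoice.on (span_type X).
HB.instance Definition _ X :=
  [SubChoice_isSubLmodule of span_type X by <:].

Definition lquot X := Quotient.quot (in_lspan X).

Section Quotient.
Variable X : set V.

HB.instance Definition _ := GRing.Zmodule.on (lquot X).
HB.instance Definition _ := EqQuotient.on (lquot X).

Lemma lquotP u v : reflect (lspan X (u - v)) (\pi_(lquot X) u == \pi_(lquot X) v).
Proof. rewrite -Quotient.idealrBE; exact: in_lspanP. Qed.

Definition lquot_scale (a : k) (x : lquot X) : lquot X :=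
  \pi_(lquot X) (a *: repr x).

Lemma lquot_piD : {morph \pi_(lquot X) : u v / u + v}.
Proof. by move=> u v; rewrite Quotient.pi_add. Qed.

Lemma lquot_scale_pi a v :
  lquot_scale a (\pi_(lquot X) v) = \pi_(lquot X) (a *: v).
Proof.
apply/eqP/lquotP; rewrite -scalerBr -[_ *: _]addr0.
have [X0 XZ] := lspan_is_submod X; apply: XZ X0.
by apply/lquotP; rewrite reprK.
Qed.

Lemma lquot_scaleA a b x :
  lquot_scale a (lquot_scale b x) = lquot_scale (a * b) x.
Proof.
by elim/quotW: x => u; rewrite (lquot_scale_pi b) !lquot_scale_pi scalerA.
Qed.

Lemma lquot_scale1 : left_id 1 lquot_scale.
Proof. by elim/quotW=> u; rewrite lquot_scale_pi scale1r. Qed.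

Lemma lquot_scaleDr : right_distributive lquot_scale +%R.
Proof.
move=> a; elim/quotW=> u; elim/quotW=> v.
by rewrite -lquot_piD !lquot_scale_pi -lquot_piD scalerDr.
Qed.

Lemma lquot_scaleDl x : {morph lquot_scale^~ x : a b / a + b}.
Proof.
move=> a b /=; elim/quotW: x => u.
by rewrite !lquot_scale_pi -lquot_piD scalerDl.
Qed.

HB.instance Definition _ := GRing.Zmodule_isLmodule.Build k (lquot X)
  lquot_scaleA lquot_scale1 lquot_scaleDr lquot_scaleDl.

Definition lproj (v : V) : lquot X := \pi_(lquot X) v.

Lemma lproj_linear : linear lproj.
Proof. by move=> a u v; rewrite /lproj lquot_piD -lquot_scale_pi. Qed.

HB.instance Definition _ := GRing.isLinear.Build k V (lquot X) *:%R lproj lproj_linear.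

End Quotient.

End Span.

Section FreeModule.
Variables (k : fieldType) (X Y : choiceType).

Definition free_map (f : X -> Y) : {freeg X / k} -> {freeg Y / k} :=
  fglift (fun x => << f x >>).

Lemma free_map_linear f : linear (free_map f).
Proof.
have liftB : {morph free_map f : u v / u - v} := lift_is_additive _.
have lift0 : free_map f 0 = 0 by rewrite -[X in free_map f X](subrr 0) liftB subrr.
have liftN u : free_map f (- u) = - free_map f u by rewrite -sub0r liftB lift0 sub0r.
have liftD : {morph free_map f : u v / u + v}.
  by move=> u v; rewrite -[v in LHS]opprK liftB liftN opprK.
have lift_sum (I : Type) (r : seq I) (F : I -> {freeg X / k}) :
    free_map f (\sum_(i <- r) F i) = \sum_(i <- r) free_map f (F i).
  exact: (big_morph _ liftD lift0).
move=> a u v; rewrite liftD; congr (_ + _).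
rewrite [a *: u]/(fgscale a u) lift_sum -[u in RHS]freeg_sumE lift_sum.
rewrite scaler_sumr; apply: eq_bigr => x _.
by rewrite /free_map !liftU scalerA.
Qed.

HB.instance Definition _ f :=
  GRing.isLinear.Build k {freeg X / k} {freeg Y / k} *:%R (free_map f)
    (free_map_linear f).

Lemma free_mapU f x : free_map f << x >> = << f x >>.
Proof. by rewrite /free_map liftU scale1r. Qed.

End FreeModule.

Section FreeModuleTheory.
Variable k : fieldType.

Lemma freeg_ind (X : choiceType) (P : {freeg X / k} -> Prop) :
  P 0 -> (forall a x u, P u -> P (a *: << x >> + u)) -> forall u, P u.
Proof.
move=> P0 PD u; rewrite -[u]freeg_sumE.
elim: (dom u) => [|x s IHs]; first by rewrite big_nil.
rewrite big_cons; set a := coeff x u.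
suff -> : << a *g x >> = a *: << x >> :> {freeg X / k} by exact: PD.
by apply/eqP/freeg_eqP=> y; rewrite coeffZ !coeffU mul1r.
Qed.

Lemma free_map_id (X : choiceType) (f : X -> X) (u : {freeg X / k}) :
  f =1 id -> free_map f u = u.
Proof.
move=> fid; elim/freeg_ind: u => [|a x u IHu]; first by rewrite linear0.
by rewrite linearP /= free_mapU fid IHu.
Qed.

Lemma free_map_comp (X Y Z : choiceType) (f : Y -> Z) (h : X -> Y)
    (u : {freeg X / k}) :
  free_map f (free_map h u) = free_map (f \o h) u.
Proof.
elim/freeg_ind: u => [|a x u IHu]; first by rewrite !linear0.
by rewrite !linearP /= !free_mapU IHu.
Qed.

End FreeModuleTheory.

(* For A a set of pairs of operators (r, l), "tensor A" is the quotient of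
   V \otimes_k W by the relations r v \otimes w = v \otimes l w.  Thus
   "tensor set0" is V \otimes_k W; if the r's (resp. l's) are the operators of
   a right (resp. left) module over a k-algebra L, for generators of L, it is
   V \otimes_L W. *)
Section Tensor.
Variables (k : fieldType) (V W : lmodType k).
Variable A : set ((V -> V) * (W -> W)).

Inductive tensor_rel : {freeg (V * W) / k} -> Prop :=
| TensorDl v v' w :
    tensor_rel (<< (v + v', w) >> - (<< (v, w) >> + << (v', w) >>))
| TensorDr v w w' :
    tensor_rel (<< (v, w + w') >> - (<< (v, w) >> + << (v, w') >>))
| TensorZl (a : k) v w : tensor_rel (<< (a *: v, w) >> - a *: << (v, w) >>)
| TensorZr (a : k) v w : tensor_rel (<< (v, a *: w) >> - a *: << (v, w) >>)
| TensorA p v w : A p -> tensor_rel (<< (p.1 v, w) >> - << (v, p.2 w) >>).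

Definition tensor := lquot tensor_rel.

HB.instance Definition _ := GRing.Lmodule.on tensor.

Definition tens (v : V) (w : W) : tensor := lproj tensor_rel << (v, w) >>.

Section Map.
Variables (f : {linear V -> V}) (g : {linear W -> W}).

Definition tensor_compat : Prop := forall p, A p ->
  (forall v, f (p.1 v) = p.1 (f v)) /\ (forall w, g (p.2 w) = p.2 (g w)).

Let F : {linear {freeg (V * W) / k} -> {freeg (V * W) / k}} :=
  free_map (fun p => (f p.1, g p.2)).

Definition tensor_map of tensor_compat := fun x : tensor =>
  lproj tensor_rel (F (repr x)).

Variable fgA : tensor_compat.

Lemma tensor_rel_map u : lspan tensor_rel u -> lspan tensor_rel (F u).
Proof.
move=> /(_ [set u | lspan tensor_rel (F u)]); apply; split=> [|{}u].
  have [X0 XZ] := lspan_is_submod tensor_rel.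
  by split=> [|a x y Fx Fy]; rewrite /= ?linear0 ?linearP //; exact: XZ.
have Frel v : tensor_rel v -> lspan tensor_rel v by move=> vA Y [_]; apply.
case=> [v v' w|v w w'|a v w|a v w|p v w Ap]; apply: Frel;
  rewrite (linearB F) ?(linearD F) ?(linearZ_LR F) /F /= !free_mapU /=.
- by rewrite linearD; exact: TensorDl.
- by rewrite linearD; exact: TensorDr.
- by rewrite linearZ; exact: TensorZl.
- by rewrite linearZ; exact: TensorZr.
by have [-> ->] := fgA Ap; exact: TensorA.
Qed.

Lemma tensor_map_proj u :
  tensor_map fgA (lproj tensor_rel u) = lproj tensor_rel (F u).
Proof.
apply/eqP/lquotP; rewrite -linearB; apply: tensor_rel_map.
by apply/lquotP; rewrite reprK.
Qed.

Lemma tensor_map_linear : linear (tensor_map fgA).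
Proof.
move=> a; elim/quotW=> u; elim/quotW=> v.
by rewrite -!/(lproj _ _) -linearP !tensor_map_proj -linearP -linearP.
Qed.

HB.instance Definition _ :=
  GRing.isLinear.Build k tensor tensor *:%R (tensor_map fgA) tensor_map_linear.

Lemma tensor_mapE v w : tensor_map fgA (tens v w) = tens (f v) (g w).
Proof. by rewrite /tens tensor_map_proj /F /= free_mapU. Qed.

End Map.

Lemma tensor_ind (P : tensor -> Prop) :
  P 0 -> (forall a v w x, P x -> P (a *: tens v w + x)) -> forall x, P x.
Proof.
move=> P0 PD; elim/quotW=> u; rewrite -/(lproj _ _).
elim/freeg_ind: u => [|a [v w] u IHu]; first by rewrite linear0.
by rewrite linearP; exact: PD.
Qed.

End Tensor.

(* A kH-module for a subgroup H of gT; the value of rep_act outside H is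
   irrelevant. *)
Record rep (k : fieldType) (gT : groupType) (H : set gT) := Rep {
  rep_space :> lmodType k;
  rep_act : gT -> {linear rep_space -> rep_space};
  rep_act1 : forall v, rep_act 1%g v = v;
  rep_actM : forall g h, H g -> H h ->
    forall v, rep_act (g * h)%g v = rep_act g (rep_act h v) }.

Definition rep_iso (k : fieldType) (gT : groupType) (H : set gT)
    (V W : rep k H) : Prop :=
  exists f : {linear V -> W}, bijective f /\
    forall h v, H h -> f (rep_act V h v) = rep_act W h (f v).

Section Induction.
Variables (k : fieldType) (gT : groupType) (H : set gT) (V : rep k H).

Local Notation kG := {freeg gT / k}.

Definition grp_lmul (g : gT) : {linear kG -> kG} :=
  free_map (fun x => g * x)%g.
Definition grp_rmul (g : gT) : {linear kG -> kG} :=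
  free_map (fun x => x * g)%g.

(* {freeg gT / k} is the group algebra kG, and the elements h of H generate
   the k-algebra kH; hence "tensor ind_rel" is kG \otimes_{kH} V. *)
Definition ind_rel : set ((kG -> kG) * (V -> V)) :=
  [set (grp_rmul h : kG -> kG, rep_act V h : V -> V) | h in H].

Lemma ind_compat g : tensor_compat ind_rel (grp_lmul g) idfun.
Proof.
move=> _ [h Hh <-]; split=> //= u; rewrite !free_map_comp.
by congr free_map; apply/funext=> x /=; rewrite mulgA.
Qed.

Definition ind_act g : {linear tensor ind_rel -> tensor ind_rel} :=
  tensor_map (ind_compat g).

Lemma ind_actE g u v : ind_act g (tens _ u v) = tens _ (grp_lmul g u) v.
Proof. exact: tensor_mapE. Qed.

Lemma ind_act1 x : ind_act 1%g x = x.
Proof.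
elim/tensor_ind: x => [|a u v x IHx]; first by rewrite linear0.
rewrite linearP IHx ind_actE; congr (_ *: tens _ _ _ + _).
exact: free_map_id mul1g.
Qed.

Lemma ind_actM g h x : ind_act (g * h)%g x = ind_act g (ind_act h x).
Proof.
elim/tensor_ind: x => [|a u v x IHx]; first by rewrite !linear0.
rewrite !linearP IHx !ind_actE /= free_map_comp.
congr (_ *: tens _ (free_map _ _) _ + _).
by apply/funext=> y /=; rewrite mulgA.
Qed.

Definition Ind : rep k [set: gT] :=
  @Rep k gT [set: gT] (tensor ind_rel) ind_act ind_act1
    (fun g h _ _ => ind_actM g h).

End Induction.

Section TensorRep.
Variables (k : fieldType) (gT : groupType) (H : set gT) (V W : rep k H).

Lemma tensor_rep_compat g :
  @tensor_compat k V W set0 (rep_act V g) (rep_act W g).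
Proof. by []. Qed.

Definition tensor_act g : {linear @tensor k V W set0 -> @tensor k V W set0} :=
  tensor_map (tensor_rep_compat g).

Lemma tensor_actE g v w :
  tensor_act g (tens set0 v w) = tens set0 (rep_act V g v) (rep_act W g w).
Proof. exact: tensor_mapE. Qed.

Lemma tensor_act1 x : tensor_act 1%g x = x.
Proof.
elim/tensor_ind: x => [|a v w x IHx]; first by rewrite linear0.
by rewrite linearP IHx tensor_actE !rep_act1.
Qed.

Lemma tensor_actM g h : H g -> H h -> forall x,
  tensor_act (g * h)%g x = tensor_act g (tensor_act h x).
Proof.
move=> Hg Hh; elim/tensor_ind => [|a v w x IHx]; first by rewrite !linear0.
by rewrite !linearP IHx !tensor_actE !rep_actM.
Qed.

Definition tensor_rep : rep k H := Rep tensor_act1 tensor_actM.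

End TensorRep.

Section SubRep.
Variables (k : fieldType) (gT : groupType) (V : rep k [set: gT]) (X : set V).

Definition span_stable : Prop :=
  forall g v, lspan X v -> lspan X (rep_act V g v).

Hypothesis XG : span_stable.

Lemma subrep_subproof g (v : span_type X) : rep_act V g (val v) \in in_lspan X.
Proof. by apply/in_lspanP; apply: XG; apply/in_lspanP; exact: (valP v). Qed.

Definition subrep_fun g (v : span_type X) : span_type X :=
  Sub (rep_act V g (val v)) (subrep_subproof g v).

Lemma subrep_linear g : linear (subrep_fun g).
Proof. by move=> a u v; apply/val_inj; rewrite /= !linearP. Qed.

HB.instance Definition _ g := GRing.isLinear.Build k (span_type X) (span_type X)
  *:%R (subrep_fun g) (subrep_linear g).

Lemma subrep_act1 v : subrep_fun 1%g v = v.
Proof. by apply/val_inj; rewrite /= rep_act1. Qed.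

Lemma subrep_actM g h : [set: gT] g -> [set: gT] h -> forall v,
  subrep_fun (g * h)%g v = subrep_fun g (subrep_fun h v).
Proof. by move=> _ _ v; apply/val_inj; rewrite /= rep_actM. Qed.

Definition span_rep : rep k [set: gT] :=
  @Rep k gT [set: gT] (span_type X) subrep_fun subrep_act1 subrep_actM.

End SubRep.

(* charM and char1 force nonzero values on a subgroup H; the values outside H
   are irrelevant. *)
Record lin_char (k : fieldType) (gT : groupType) (H : set gT) := LinChar {
  char_val :> gT -> k;
  char1 : char_val 1%g = 1;
  charM : forall g h, H g -> H h -> char_val (g * h)%g = char_val g * char_val h }.

Section CharRep.
Variables (k : fieldType) (gT : groupType) (H : set gT) (theta : lin_char k H).

Definition char_act (g : gT) : {linear k^o -> k^o} := *:%R (theta g).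

Lemma char_act1 v : char_act 1%g v = v.
Proof. by rewrite /= char1 scale1r. Qed.

Lemma char_actM g h : H g -> H h -> forall v,
  char_act (g * h)%g v = char_act g (char_act h v).
Proof. by move=> Hg Hh v; rewrite /= charM // scalerA. Qed.

Definition char_rep : rep k H := Rep char_act1 char_actM.

End CharRep.

Definition triv_rep (k : fieldType) (gT : groupType) (H : set gT) : rep k H :=
  @Rep k gT H k^o (fun _ => idfun) (fun _ => erefl) (fun _ _ _ _ _ => erefl).

Section Inflation.
Variables (k : fieldType) (gT : groupType) (B T U : set gT).
Hypothesis BTU : semidirect B T U.
Variable V : rep k T.

Definition Tpart (b : gT) : gT := xget 1%g [set t | T t /\ U (t^-1 * b)%g].

Lemma Tpart_eq t b : T t -> U (t^-1 * b)%g -> Tpart b = t.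
Proof.
move=> Tt Utb; apply: xget_subset1; first by [].
move=> x y [Tx Ux] [Ty Uy].
case: BTU => -[T1 TM TV] [[U1 UM UV] _ _] TU _.
suff : (T `&` U) (x^-1 * y)%g.
  by rewrite TU /= => /(congr1 (fun z => x * z)%g); rewrite mulVKg mulg1.
split; first by apply: TM => //; exact: TV.
have -> : (x^-1 * y = (x^-1 * b) * (y^-1 * b)^-1)%g.
  by rewrite invgM invgK mulgA mulgK.
by apply: UM => //; exact: UV.
Qed.

Lemma TpartP b : B b -> T (Tpart b) /\ U ((Tpart b)^-1 * b)%g.
Proof.
case: (BTU) => _ _ _ <- [t Tt [u Uu <-]].
by rewrite (@Tpart_eq t) ?mulKg.
Qed.

Lemma Tpart1 : Tpart 1%g = 1%g.
Proof.
case: (BTU) => -[T1 _ _] [[U1 _ _] _ _] _ _.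
by apply: Tpart_eq => //; rewrite mulg1 invg1.
Qed.

Lemma TpartM b c : B b -> B c -> Tpart (b * c)%g = (Tpart b * Tpart c)%g.
Proof.
move=> /TpartP [Tb Ub] /TpartP [Tc Uc].
case: (BTU) => -[T1 TM TV] [[U1 UM UV] UB UN] _ TUB.
apply: Tpart_eq; first exact: TM.
set t := Tpart b in Tb Ub *; set t' := Tpart c in Tc Uc *.
have -> : ((t * t')^-1 * (b * c) =
   (t'^-1 * (t^-1 * b) * t'^-1^-1) * (t'^-1 * c))%g.
  by rewrite invgM invgK !mulgA mulgK.
apply: UM => //; have Bt : B (t'^-1)%g.
  by rewrite -TUB; exists (t'^-1)%g; [exact: TV|exists 1%g => //; rewrite mulg1].
by rewrite -(UN _ Bt); exists (t^-1 * b)%g.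
Qed.

Lemma infl_act1 v : rep_act V (Tpart 1%g) v = v.
Proof. by rewrite Tpart1 rep_act1. Qed.

Lemma infl_actM b c : B b -> B c -> forall v,
  rep_act V (Tpart (b * c)%g) v = rep_act V (Tpart b) (rep_act V (Tpart c) v).
Proof.
move=> Bb Bc v; rewrite TpartM // rep_actM //; exact: (TpartP _).1.
Qed.

Definition infl : rep k B :=
  @Rep k gT B V (fun b => rep_act V (Tpart b)) infl_act1 infl_actM.

End Inflation.

Section Steinberg.
Variables (k : fieldType) (K : closedFieldType) (G : alg_group K).
Variables (B N U : set G) (S : set (set G)).

Let T := B `&` N.

Definition M_ind (bn : split_BN_pair B N U S) (theta : lin_char k T) :
    rep k [set: G] :=
  Ind (infl (bn_B_semidirect bn) (char_rep theta)).

Definition M_tr : rep k [set: G] := Ind (triv_rep k B).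

(* n \otimes 1_tr does not depend on the representative n of the coset w; any
   one is chosen. *)
Definition coset_1tr (w : set G) : M_tr :=
  tens _ (<< xget 1%g w >> : {freeg G / k}) (1 : k^o).

(* Sums over "\in" are finitely supported sums, with value 0 when the support
   is infinite; here N / T is a finite set, by the axioms of a split BN-pair. *)
Definition steinberg_vec : M_tr :=
  \sum_(w \in cosets N T) (-1) ^+ coset_length T S w *: coset_1tr w.

(* The k-span of these vectors is kU steinberg_vec. *)
Definition steinberg_gens : set M_tr :=
  [set rep_act M_tr u steinberg_vec | u in U].

Definition St_stable : Prop := span_stable steinberg_gens.

Definition St (h : St_stable) : rep k [set: G] := span_rep h.

End Steinberg.

(* Main.v *)
(** Restricted to B, the Steinberg module is free of rank one over kU, that is
St = Ind_T^B k_tr; so M(theta) \otimes St = Ind_B^G (k_theta \otimes Ind_T^B k_tr)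
= Ind_T^G k_theta. Explicitly, g \otimes 1 corresponds to
(g \otimes 1) \otimes g e, where e = \sum_w (-1)^l(w) w 1_tr.

That e spans a kG-submodule which is free over kU is seen by identifying it
with the common kernel of the maps k[G/B] -> k[G/P_s], s in S: this kernel is
visibly G-stable and contains e, and its elements are determined by their
coefficients on the big cell B w0 B / B, on which U acts simply transitively.

The finiteness of W comes from Noetherianity: if n B s never meets B n B, then
B `&` (n s) B (n s)^-1 is a strictly smaller closed subset than
B `&` n B n^-1. So some w0 has w0 B s meeting B w0 B for all s in S; then every
y in W satisfies w0 \in B w0 B y B, whence y is w0^-1 times a subword of w0. *)

Require Import Defs.
From HB Require Import structures.
From mathcomp Require Import all_boot all_order all_algebra.
From mathcomp Require Import generic_quotient.
From mathcomp Require Import boolp classical_sets functions cardinality fsbigop.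
From mathcomp Require Import freeg mpoly.

Set Implicit Arguments.
Unset Strict Implicit.
Unset Printing Implicit Defensive.

Import Order.TTheory GRing.Theory.

Local Open Scope classical_set_scope.

(** * Descending chains of closed subsets *)

(** The subsequence visits positions where [f] attains its minimum over the remaining tail, so each
    of its values bounds all later ones from below. *)
Lemma nat_nondecreasing_subseq (f : nat -> nat) :
  exists phi : nat -> nat, {homo phi : i j / i < j} /\
    {homo f \o phi : i j / i <= j}.
Proof.
have tail_min n : exists m, n <= m /\ forall p, m <= p -> f m <= f p.
  have exv : exists v, `[< exists2 p, n <= p & f p = v >].
    by exists (f n); apply/asboolP; exists n.
  case: (ex_minnP exv) => v /asboolP [m nm <-] vmin.
  by exists m; split=> // p mp; apply/vmin/asboolP; exists p => //; exact: leq_trans mp.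
have [h hP] := choice tail_min.
pose phi := fix phi k := if k is k'.+1 then h (phi k').+1 else h 0.
have phiS k : phi k < phi k.+1 by have [] := hP (phi k).+1.
exists phi; split; first exact: homo_ltn ltn_trans phiS.
apply: homo_leq leqnn leq_trans _ => k /=.
have kS := ltnW (phiS k).
by case: k kS => [|k] kS; apply: (hP _).2 kS.
Qed.

(* Dickson's lemma. *)
Lemma mnm_good_pair n (u : nat -> 'X_{1..n}) :
  exists i j, i < j /\ (u i <= u j)%MM.
Proof.
(* The exponents are made nondecreasing one variable at a time; a further subsequence keeps those
   already treated. *)
suff /(_ (enum 'I_n)) [phi [phi_lt phi_le]] : forall s : seq 'I_n,
    exists phi : nat -> nat, {homo phi : i j / i < j} /\
      forall x, x \in s -> {homo (fun i => u (phi i) x) : i j / i <= j}.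
  exists (phi 0), (phi 1); split; first exact: phi_lt.
  by apply/mnm_lepP => x; apply: phi_le; rewrite ?mem_enum.
elim=> [|x s [phi [phi_lt phi_le]]]; first by exists id; split.
have [psi [psi_lt psi_le]] := nat_nondecreasing_subseq (fun i => u (phi i) x).
exists (phi \o psi); split=> [i j ij|y]; first exact/phi_lt/psi_lt.
rewrite inE => /predU1P [->|ys] i j ij; first exact: psi_le.
by apply: phi_le => //; exact: (ltnW_homo psi_lt).
Qed.

(** Hilbert's basis theorem, as the ascending chain condition. In a strictly increasing chain,
    choose [f i] in [I i.+1] outside [I i] with minimal leading monomial. By Dickson's lemma some
    [mlead (f i)] divides a later [mlead (f j)], and reducing [f j] by [f i] contradicts
    minimality. *)
Lemma mpoly_ideal_chain (K : fieldType) n (I : nat -> set {mpoly K[n]}) :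
    (forall i, I i 0%R) ->
    (forall i p q, I i p -> I i q -> I i (p - q)%R) ->
    (forall i (p q : {mpoly K[n]}), I i p -> I i (q * p)%R) ->
    {homo I : i j / i <= j >-> i `<=` j} ->
  exists i, I i.+1 `<=` I i.
Proof.
move=> I0 IB IM Imono; apply: contrapT => /forallNP Istrict.
have minp i : exists p, [/\ I i.+1 p, ~ I i p &
    forall q, I i.+1 q -> ~ I i q -> (mlead p <= mlead q)%O].
  have /existsNP [p /not_implyP [pS pN]] := Istrict i.
  have [m mp] : exists m, mlead p = m by exists (mlead p).
  elim/(@ltmwf n): m p mp pS pN => m IHm p mp pS pN.
  have [pmin|] := pselect (forall q, I i.+1 q -> ~ I i q -> (mlead p <= mlead q)%O).
    by exists p.
  move=> /existsNP [q /not_implyP [qS /not_implyP [qN /negP]]].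
  by rewrite -ltNge mp => /IHm; apply.
have [f fP] := choice minp.
have f0 i : f i != 0%R.
  by apply/eqP => fi0; case: (fP i) => _ + _; rewrite fi0; apply.
have [i [j [ij le_ij]]] := mnm_good_pair (fun i => mlead (f i)).
have [fjS fjN fjmin] := fP j; have [fiS _ _] := fP i.
pose c := (mleadc (f j) / mleadc (f i))%R.
have ci0 : mleadc (f i) != 0%R by rewrite mleadc_eq0.
have cj0 : mleadc (f j) != 0%R by rewrite mleadc_eq0.
have c0 : c != 0%R by rewrite mulf_neq0 // invr_eq0.
(* A multiple of [f i], hence an element of [I j], with the same leading term as [f j]. *)
pose h := ((c *: 'X_[mlead (f j) - mlead (f i)]) * f i)%R.
have X0 : ('X_[mlead (f j) - mlead (f i)] : {mpoly K[n]}) != 0%R.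
  by rewrite -mleadc_eq0 mleadXm mcoeffX eqxx oner_eq0.
have qlead : mlead (c *: 'X_[mlead (f j) - mlead (f i)]) = (mlead (f j) - mlead (f i))%MM.
  by rewrite mleadZ // mleadXm.
have hlead : mlead h = mlead (f j).
  by rewrite mleadM ?scaler_eq0 ?negb_or ?c0 // qlead submK.
have hc : (h@_(mlead (f j)) = mleadc (f j))%R.
  rewrite -[X in (h@_X)%R](submK le_ij) -qlead mleadcM.
  by rewrite mleadcZE mleadXm mcoeffX eqxx mulr1 divfK.
have Ih : I j h by apply: IM; exact: (Imono _ _ ij).
have gN : ~ I j (f j - h)%R.
  move=> Ig; apply: fjN; rewrite -[f j](subrK h) -[X in (_ + X)%R]opprK.
  by apply: (IB) => //; rewrite -sub0r; exact: IB.
have gS : I j.+1 (f j - h)%R by apply: IB => //; exact: (Imono _ _ (leqnSn j)).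
have := fjmin _ gS gN; apply/negP; rewrite -ltNge lt_neqAle.
have -> /= : (mlead (f j - h) <= mlead (f j))%O.
  by apply: le_trans (mleadB_le _ _) _; rewrite hlead joinxx.
rewrite andbT; apply/eqP => gl; apply: gN.
suff -> : (f j - h)%R = 0%R by exact: I0.
by apply/eqP; rewrite -mleadc_eq0 gl mcoeffB hc subrr.
Qed.

(** The map [A -> P A Q] is linear in the entries, so composing with it substitutes the linear forms
    [lq] for the variables. *)
Lemma mpoly_comp_linear (K : fieldType) n (P Q : 'M[K]_n) (p : {mpoly K[n * n]}) :
  exists q : {mpoly K[n * n]}, forall A : 'M[K]_n,
    (q.@[fun i => mxvec A 0 i] = p.@[fun i => mxvec (P *m A *m Q) 0 i])%R.
Proof.
pose f := (mulmxr Q \o mulmx P)%FUN.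
pose lq := [tuple (\sum_j (lin_mx f) j i *: 'X_j : {mpoly K[n * n]})%R | i < n * n].
exists (p \mPo lq) => A; rewrite comp_mpoly_meval; congr (meval _ _).
apply/funext => i; rewrite tnth_mktuple -[(P *m A *m Q)%R]/(f A) -mul_vec_lin mxE.
rewrite (raddf_sum (meval _)); apply: eq_bigr => j _.
by rewrite /= mevalZ mevalXU mulrC.
Qed.

Section AlgGroup.
Variables (K : closedFieldType) (G : alg_group K).

Lemma ag_mx_unit (g : G) : ag_mx g \in unitmx.
Proof.
have : (ag_mx g *m ag_mx (g^-1)%g = 1%:M)%R by rewrite -ag_mxM mulgV ag_mx1.
by case/mulmx1_unit.
Qed.

(** The vanishing ideals [I i] of the decreasing sets [X i] fail to grow at some step; as conjugates
    of the closed set [B] are again cut out by polynomials, the sets do not shrink at that step. *)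
Lemma conj_by_chain (B : set G) (u : nat -> G) : ag_closed B ->
    (forall i, B `&` conj_by (u i.+1) B `<=` conj_by (u i) B) ->
  exists i, B `&` conj_by (u i) B `<=` conj_by (u i.+1) B.
Proof.
move=> [J BJ] uB; pose X i := B `&` conj_by (u i) B.
pose I i := [set p : {mpoly K[ag_dim G * ag_dim G]} |
  forall x, X i x -> (p.@[fun i => mxvec (ag_mx x) 0 i] = 0)%R].
have Xmono i j : i <= j -> X j `<=` X i.
  elim: j => [|j IHj]; first by rewrite leqn0 => /eqP ->.
  rewrite leq_eqVlt => /predU1P [-> //|/IHj]; apply: subset_trans => x [Bx ux].
  by split=> //; exact: uB.
have [i Ii] : exists i, I i.+1 `<=` I i.
  apply: mpoly_ideal_chain => [i x _|i p q Ip Iq x Xx|i p q Ip x Xx|i j ij p Ip x Xx].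
  - exact: meval0.
  - by rewrite mevalB Ip // Iq // subr0.
  - by rewrite mevalM Ip // mulr0.
  - exact/Ip/(Xmono i j).
exists i => x Xx; set g := u i.+1.
have [Bx _] := Xx.
suff : (@ag_mx K G @` B) (ag_mx (g^-1 * x * g)%g).
  case=> b Bb /ag_mx_inj bE; exists b => //.
  by rewrite bE !mulgA mulgV mul1g mulgK.
rewrite BJ; split=> [|p Jp]; first exact: ag_mx_unit.
(* [q] is the equation [p] of [B] pulled back along [x -> g^-1 x g]. It vanishes on [X i.+1], hence
   on [X i]. *)
have [q qE] := mpoly_comp_linear (ag_mx g^-1%g) (ag_mx g) p.
rewrite !ag_mxM -qE; apply: (Ii q) => // y [By [b Bb bE]]; rewrite qE.
have : (@ag_mx K G @` B) (ag_mx b) by exists b.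
rewrite BJ => -[_ /(_ p Jp)].
by rewrite -!ag_mxM -/g -bE !mulgA mulVg mul1g mulgVK.
Qed.

End AlgGroup.

(** * The Bruhat decomposition and the length function *)

Lemma foldr_mulgr (gT : groupType) (t g : gT) ns :
  (foldr *%g t ns * g)%g = foldr *%g (t * g)%g ns.
Proof. by elim: ns => //= a ns <-; rewrite mulgA. Qed.

Definition groupE := (@invgM, @invgK, @invg1, @mulgA, @mulgK, @mulgVK, @mulVg,
  @mulgV, @mul1g, @mulg1).

Section BNTheory.
Variables (K : closedFieldType) (G : alg_group K).
Variables (B N U : set G) (S : set (set G)).
Hypothesis bn : split_BN_pair B N U S.

Local Notation T := (B `&` N).

Lemma B1 : B 1%g. Proof. by have [[]] := bn_B bn. Qed.
Lemma BM g h : B g -> B h -> B (g * h)%g.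
Proof. by have [[_ H _] _] := bn_B bn; exact: H. Qed.
Lemma BV g : B g -> B (g^-1)%g.
Proof. by have [[_ _ H] _] := bn_B bn; exact: H. Qed.

Lemma N1 : N 1%g. Proof. by have [[]] := bn_N bn. Qed.
Lemma NM g h : N g -> N h -> N (g * h)%g.
Proof. by have [[_ H _] _] := bn_N bn; exact: H. Qed.
Lemma NV g : N g -> N (g^-1)%g.
Proof. by have [[_ _ H] _] := bn_N bn; exact: H. Qed.

Lemma T1 : T 1%g. Proof. by split; [exact: B1|exact: N1]. Qed.
Lemma TM g h : T g -> T h -> T (g * h)%g.
Proof. by move=> [Bg Ng] [Bh Nh]; split; [exact: BM|exact: NM]. Qed.
Lemma TV g : T g -> T (g^-1)%g.
Proof. by move=> [Bg Ng]; split; [exact: BV|exact: NV]. Qed.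
Lemma TB t : T t -> B t. Proof. by case. Qed.
Lemma TN t : T t -> N t. Proof. by case. Qed.

Lemma TJ n t : N n -> T t -> T (n * t * n^-1)%g.
Proof.
by move=> Nn Tt; have [_ _ TN] := bn_T_normal bn; rewrite -(TN n Nn); exists t.
Qed.

Lemma TJV n t : N n -> T t -> T (n^-1 * t * n)%g.
Proof. by move=> /NV Nn /(TJ Nn); rewrite invgK. Qed.

(** * Simple reflections, words and lengths, expressed on representatives in [N] *)

Definition simple (n : G) : Prop := exists2 s, S s & s n.

Lemma simple_coset s n : S s -> s n -> N n /\ s = lcoset n T.
Proof.
move=> Ss; have [m Nm <-] := bn_S_sub bn Ss; case=> t Tt <-.
split; first exact: NM (TN Tt).
apply/seteqP; split=> _ [t' Tt' <-].
  by exists (t^-1 * t')%g; rewrite ?groupE//; exact: TM (TV _) _.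
by exists (t * t')%g; rewrite ?groupE//; exact: TM.
Qed.

Lemma simple_N s : simple s -> N s.
Proof. by move=> [w Sw /(simple_coset Sw)[]]. Qed.

Lemma simpleT s t : simple s -> T t -> simple (s * t)%g.
Proof.
move=> [w Sw ws] Tt; exists w => //.
by have [_ ->] := simple_coset Sw ws; exists t.
Qed.

Lemma simple_sqr s : simple s -> T (s * s)%g.
Proof.
by move=> [w Sw ws]; have [_ <-] := bn_S_order2 bn Sw; exists s => //; exists s.
Qed.

Lemma simple_notT s : simple s -> ~ T s.
Proof.
move=> [w Sw ws] Ts; have [wT _] := bn_S_order2 bn Sw; apply: wT.
have [_ ->] := simple_coset Sw ws; apply/seteqP; split=> [_ [t Tt <-]|t Tt].
  exact: TM.
by exists (s^-1 * t)%g; rewrite ?groupE//; exact: TM (TV _) _.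
Qed.

Lemma simpleV s : simple s -> simple (s^-1)%g.
Proof.
move=> sS; have -> : (s^-1 = s * (s * s)^-1)%g by rewrite !groupE.
exact/simpleT/TV/simple_sqr.
Qed.

(** The trailing [t] absorbs the choice of representatives modulo [T]. *)
Definition word (m : nat) (n : G) : Prop := exists ns t,
  [/\ size ns = m, forall s, s \in ns -> simple s, T t & n = foldr *%g t ns].

Lemma word_N m n : word m n -> N n.
Proof.
move=> [ns [t [_ + Tt ->]]]; elim: ns => [|s ns IHns] nsS /=; first exact: TN.
apply: NM; first by apply/simple_N/nsS; rewrite inE eqxx.
by apply: IHns => s' s'ns; apply: nsS; rewrite inE s'ns orbT.
Qed.

Lemma wordE m n : N n -> coset_word T S (lcoset n T) m <-> word m n.
Proof.
move=> Nn; split.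
  move=> [ws [<- wsS wsE]].
  have : foldr (@set_mul G) T ws n by rewrite wsE; exists 1%g; rewrite ?mulg1//; exact: T1.
  elim: ws n wsS {Nn wsE} => [|w ws IHws] n wsS /=; first by exists [::], n.
  case=> s ws' [n' wn' <-].
  have [|ns [t [nsm nsS Tt ->]]] := IHws n' _ wn'.
    by move=> s' s'ns; apply: wsS; rewrite inE s'ns orbT.
  exists (s :: ns), t; split=> //=; first by rewrite nsm.
  move=> s'; rewrite inE => /predU1P [->|]; last exact: nsS.
  by exists w => //; apply: wsS; rewrite inE eqxx.
move=> [ns [t [<- nsS Tt ->]]].
elim: ns nsS => [_|s ns IHns nsS].
  exists [::]; split=> //=; apply/seteqP; split=> [t' Tt'|_ [t' Tt' <-]]; last exact: TM.
  by exists (t^-1 * t')%g; rewrite ?groupE//; exact: TM (TV _) _.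
have nsS' s' : s' \in ns -> simple s'.
  by move=> s'ns; apply: nsS; rewrite inE s'ns orbT.
have [ws [wsn wsS wsE]] := IHns nsS'.
have [w Sw ws'] : simple s by apply: nsS; rewrite inE eqxx.
have [Ns wE] := simple_coset Sw ws'.
have Nx : N (foldr *%g t ns) by apply: (@word_N (size ns)); exists ns, t.
exists (w :: ws); split=> /=; first by rewrite wsn.
  by move=> s'; rewrite inE => /predU1P [->|]; last exact: wsS.
set x := foldr *%g t ns in wsE Nx *.
rewrite wsE wE; apply/seteqP; split.
  move=> _ [_ [t1 Tt1 <-] [_ [t2 Tt2 <-] <-]].
  exists (x^-1 * t1 * x * t2)%g; first exact: TM (TJV _ _) _.
  by rewrite !groupE.
move=> _ [t1 Tt1 <-]; exists s; first by exists 1%g; rewrite ?mulg1//; exact: T1.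
by exists (x * t1)%g; [exists t1|rewrite mulgA].
Qed.

Definition len (n : G) : nat := coset_length T S (lcoset n T).

Lemma len_spec n : N n -> word (len n) n /\ forall m, word m n -> len n <= m.
Proof.
move=> Nn; rewrite /len /coset_length; case: pselect => [ex|[]]; last first.
  have [m wm] := bn_S_gen bn (imageP (fun n => lcoset n T) Nn).
  by exists m; apply/asboolP.
case: (ex_minnP ex) => m /asboolP /(wordE _ Nn) wm mmin; split=> // m' wm'.
by apply/mmin/asboolP/wordE.
Qed.

Lemma lenP n : N n -> word (len n) n. Proof. by case/len_spec. Qed.

Lemma len_le m n : word m n -> len n <= m.
Proof. by move=> w; have [_] := len_spec (word_N w); apply. Qed.

Lemma wordT m n t : word m n -> T t -> word m (n * t)%g.
Proof.
move=> [ns [t' [nsm nsS Tt' ->]]] Tt; exists ns, (t' * t)%g; split=> //.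
  exact: TM.
exact: foldr_mulgr.
Qed.

Lemma word_mull m s n : simple s -> word m n -> word m.+1 (s * n)%g.
Proof.
move=> sS [ns [t [<- nsS Tt ->]]]; exists (s :: ns), t; split=> //= s'.
by rewrite inE => /predU1P [->|]; last exact: nsS.
Qed.

Lemma word_mulr m s n : simple s -> word m n -> word m.+1 (n * s)%g.
Proof.
move=> sS [ns [t [<- nsS Tt ->]]]; exists (rcons ns s), (s^-1 * t * s)%g.
split; first by rewrite size_rcons.
- move=> s'; rewrite mem_rcons inE => /predU1P [->//|]; exact: nsS.
- exact/TJV/Tt/simple_N.
- by rewrite foldr_rcons foldr_mulgr !groupE.
Qed.

Lemma word_invl m n : word m.+1 n ->
  exists s n', [/\ simple s, word m n' & n = (s * n')%g].
Proof.
move=> [[|s ns] [t [//= [nsm] nsS Tt ->]]]; exists s, (foldr *%g t ns); split=> //.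
  by apply: nsS; rewrite inE eqxx.
by exists ns, t; split=> // s' s'ns; apply: nsS; rewrite inE s'ns orbT.
Qed.

Lemma word_invr m n : word m.+1 n ->
  exists s n', [/\ simple s, word m n' & n = (n' * s)%g].
Proof.
move=> [ns [t []]]; case/lastP: ns => [//|ns s]; rewrite size_rcons => -[nsm] nsS Tt ->.
exists (s * t)%g, (foldr *%g 1%g ns); split.
- by apply: simpleT => //; apply: nsS; rewrite mem_rcons inE eqxx.
- exists ns, 1%g; split=> //; last exact: T1.
  by move=> s' s'ns; apply: nsS; rewrite mem_rcons inE s'ns orbT.
- by rewrite foldr_mulgr mul1g foldr_rcons.
Qed.

Lemma lenT n t : N n -> T t -> len (n * t)%g = len n.
Proof.
move=> Nn Tt; apply/eqP; rewrite eqn_leq !len_le//; last by apply: wordT Tt; exact: lenP.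
have -> : n = (n * t * t^-1)%g by rewrite !groupE.
by apply: wordT (TV Tt); rewrite mulgK; exact/lenP/NM/TN.
Qed.

Lemma len_mulr n s : N n -> simple s -> len (n * s)%g <= (len n).+1.
Proof. by move=> Nn sS; apply/len_le/word_mulr/lenP. Qed.

Lemma len_mull n s : N n -> simple s -> len (s * n)%g <= (len n).+1.
Proof. by move=> Nn sS; apply/len_le/word_mull/lenP. Qed.

Lemma len_mulr_ge n s : N n -> simple s -> len n <= (len (n * s)%g).+1.
Proof.
move=> Nn sS; rewrite -{1}[n](mulgK s); apply: len_mulr; last exact: simpleV.
exact/NM/simple_N.
Qed.

Lemma len_eq0 n : N n -> len n = 0 -> T n.
Proof.
by move=> /lenP + n0; rewrite n0 => -[ns [t [/size0nil -> _ Tt ->]]].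
Qed.

Lemma len_predr n : N n -> 0 < len n ->
  exists s n', [/\ simple s, N n', n = (n' * s)%g & len n = (len n').+1].
Proof.
move=> Nn n0; have [s [n' [sS wn' nE]]] : exists s n',
    [/\ simple s, word (len n).-1 n' & n = (n' * s)%g].
  by apply: word_invr; rewrite prednK//; exact: lenP.
have Nn' := word_N wn'; exists s, n'; split=> //; apply/eqP; rewrite eqn_leq.
by rewrite {1}nE len_mulr//= -[leqRHS]prednK// ltnS len_le.
Qed.

Lemma len_predl n : N n -> 0 < len n ->
  exists s n', [/\ simple s, N n', n = (s * n')%g & len n = (len n').+1].
Proof.
move=> Nn n0; have [s [n' [sS wn' nE]]] : exists s n',
    [/\ simple s, word (len n).-1 n' & n = (s * n')%g].
  by apply: word_invl; rewrite prednK//; exact: lenP.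
have Nn' := word_N wn'; exists s, n'; split=> //; apply/eqP; rewrite eqn_leq.
by rewrite {1}nE len_mull//= -[leqRHS]prednK// ltnS len_le.
Qed.

(** * Products of Bruhat cells *)

Definition dcoset (n : G) : set G :=
  [set g | exists b b', [/\ B b, B b' & g = (b * n * b')%g]].

Lemma dcoset_refl n : dcoset n n.
Proof. by exists 1%g, 1%g; rewrite !groupE; split=> //; exact: B1. Qed.

Lemma dcosetM n g b b' : B b -> B b' -> dcoset n g -> dcoset n (b * g * b')%g.
Proof.
move=> Bb Bb' [c [c' [Bc Bc' ->]]]; exists (b * c)%g, (c' * b')%g.
by rewrite !groupE; split=> //; exact: BM.
Qed.

Lemma dcosetMl n g b : B b -> dcoset n g -> dcoset n (b * g)%g.
Proof. by move=> Bb /(dcosetM Bb B1); rewrite mulg1. Qed.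

Lemma dcosetMr n g b : B b -> dcoset n g -> dcoset n (g * b)%g.
Proof. by move=> Bb /(dcosetM B1 Bb); rewrite mul1g. Qed.

Lemma dcoset_sym n g : dcoset n g -> dcoset g n.
Proof.
move=> [b [b' [Bb Bb' ->]]]; exists (b^-1)%g, (b'^-1)%g.
by rewrite !groupE; split=> //; exact: BV.
Qed.

Lemma dcoset_trans n m g : dcoset n m -> dcoset m g -> dcoset n g.
Proof. by move=> nm [b [b' [Bb Bb' ->]]]; exact: dcosetM. Qed.

Lemma dcosetV n g : dcoset n g -> dcoset (n^-1)%g (g^-1)%g.
Proof.
move=> [b [b' [Bb Bb' ->]]]; exists (b'^-1)%g, (b^-1)%g.
by rewrite !groupE; split=> //; exact: BV.
Qed.

Lemma cell_l s n b : simple s -> N n -> B b ->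
  dcoset (s * n)%g (s * b * n)%g \/ dcoset n (s * b * n)%g.
Proof.
move=> [w Sw ws] Nn Bb.
have [] := bn_cell bn Sw ws Nn (imageP (fun b => s * b * n)%g Bb).
  by move=> [_ [c Bc [_ -> <-]] [c' Bc' <-]]; left; exists c, c'.
by move=> [_ [c Bc [_ -> <-]] [c' Bc' <-]]; right; exists c, c'.
Qed.

(** The mirror image of axiom (iv), by taking inverses. *)
Lemma cell_r s n b : simple s -> N n -> B b ->
  dcoset (n * s)%g (n * b * s)%g \/ dcoset n (n * b * s)%g.
Proof.
move=> sS Nn Bb.
have E : (n * b * s = (s^-1 * b^-1 * n^-1)^-1)%g by rewrite !groupE.
have [/dcosetV|/dcosetV] := cell_l (simpleV sS) (NV Nn) (BV Bb); rewrite E.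
  by rewrite ?groupE; left.
by rewrite ?groupE; right.
Qed.

(** Uniqueness in the Bruhat decomposition, by induction on the length of the shorter element
    [n = n' s]. Removing [s] puts [n'] in [B m s^-1 B], where induction applies, or in [B m B]; then
    [m] would have the length of [n'], less than that of [n]. *)
Lemma dcoset_inj n m : N n -> N m -> dcoset n m -> T (n^-1 * m)%g.
Proof.
have key q : forall n m, len n = q -> len n <= len m -> N n -> N m ->
    dcoset n m -> T (n^-1 * m)%g.
  elim: q => [|q IHq] {}n {}m nq nm Nn Nm.
    move=> [b [b' [Bb Bb' mE]]]; have Tn := len_eq0 Nn nq.
    apply: TM (TV Tn) _; split=> //; rewrite mE; apply: BM => //.
    exact/BM/TB.
  have [|s [n' [sS Nn' nE nn']]] := len_predr Nn; first by rewrite nq.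
  move: nn'; rewrite nq => -[qn'] /dcoset_sym [c [c' [Bc Bc' n'sE]]].
  have n'E : n' = (c * (m * c' * s^-1))%g by rewrite !mulgA -n'sE nE !groupE.
  have Ns := simple_N sS.
  have [|] := cell_r (simpleV sS) Nm Bc' => /(dcosetMl Bc); rewrite -n'E => mn'.
    have /(TJV Ns) : T (n'^-1 * (m * s^-1))%g.
      apply: IHq (dcoset_sym mn') => //; last exact/NM/NV.
      by rewrite -ltnS (leq_trans _ (len_mulr_ge Nm (simpleV sS)))// -qn' -nq.
    by rewrite nE !groupE.
  have Tnm : T (n'^-1 * m)%g.
    by apply: IHq (dcoset_sym mn') => //; rewrite -qn' (leq_trans _ nm)// nq qn'.
  by move: nm; rewrite -[m](mulVKg n') lenT// -qn' nq ltnn.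
move=> Nn Nm nm; have [le_nm|/ltnW le_mn] := leqP (len n) (len m).
  exact: key nm.
rewrite -[X in T X]invgK invgM invgK; apply: TV.
exact: key (dcoset_sym nm).
Qed.

(** Induction on the length of [n = t n']. If [n b s] fell in [B n B], then [n' b s], which lies in
    [B n' s B] by induction, would also lie in [B n' B] or in [B n B]. By uniqueness of cells,
    either [s] is in [T], or [n s] has the coset of [n'] and is shorter than [n]. *)
Lemma cell_up n s b : N n -> simple s -> len n <= len (n * s)%g -> B b ->
  dcoset (n * s)%g (n * b * s)%g.
Proof.
move: {2}(len n) (erefl (len n)) => q.
elim: q n s b => [|q IHq] n s b nq Nn sS nns Bb.
  have /TB Bn := len_eq0 Nn nq.
  have -> : (n * b * s = (n * b * n^-1) * (n * s))%g by rewrite !groupE.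
  by apply: dcosetMl (dcoset_refl _); apply: BM (BV Bn); exact: BM.
have [//|[c [c' [Bc Bc' nbsE]]]] := cell_r sS Nn Bb.
have [|t [n' [tS Nn' nE nn']]] := len_predl Nn; first by rewrite nq.
have Ns := simple_N sS.
have {IHq} n's : dcoset (n' * s)%g (n' * b * s)%g.
  apply: IHq => //; first by move: nn'; rewrite nq => -[].
  rewrite -ltnS -nn' (leq_trans nns)// nE -mulgA len_mull//; exact: NM.
have n'bsE : (n' * b * s = t^-1 * c * n * c')%g.
  have -> : (t^-1 * c * n * c' = t^-1 * (c * n * c'))%g by rewrite !mulgA.
  by rewrite -nbsE nE !groupE.
have [|] := cell_l (simpleV tS) Nn Bc => /(dcosetMr Bc'); rewrite -n'bsE.
  rewrite nE mulKg => /dcoset_sym/(dcoset_trans n's)/dcoset_inj.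
  rewrite !groupE => /(_ (NM Nn' Ns) Nn') /TV.
  by rewrite invgK => /(simple_notT sS).
move=> /dcoset_sym/(dcoset_trans n's)/dcoset_inj => /(_ (NM Nn' Ns) Nn).
set t' := (_ * n)%g => Tt'.
have E : (n * s = n' * ((s * t' * s^-1) * (s * s)))%g by rewrite !groupE.
move: nns; rewrite E lenT//; first by rewrite nn' ltnn.
by apply: TM (simple_sqr sS); exact: TJ.
Qed.

(** Axiom (iii) with [s^-1] on the right: as [s * s] lies in [T], the inclusion of [s B s^-1] in [B]
    would already force [s B s = B]. *)
Lemma simple_thick s : simple s -> exists2 b, B b & ~ B (s * b * s^-1)%g.
Proof.
move=> sS; apply: contrapT => /forall2NP sB.
have {}sB b : B b -> B (s * b * s^-1)%g.
  by move=> Bb; have [//|/contrapT] := sB b.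
have Bss : B (s * s)%g by case: (simple_sqr sS).
have [w Sw ws] := sS; apply: (bn_neq bn Sw ws); apply/seteqP; split.
  move=> _ [b Bb <-]; have -> : (s * b * s = s * b * s^-1 * (s * s))%g by rewrite !groupE.
  by apply: BM => //; exact: sB.
move=> b Bb; exists ((s * s)^-1 * (s * b * s^-1))%g; last by rewrite !groupE.
by apply: BM; [exact: BV|exact: sB].
Qed.

(** Multiplication by [s^-1] lengthens [n s], so [n (s b s^-1)] lies in [B n B] for every [b] in
    [B]; for the [b] of [simple_thick], the factor [s b s^-1] lies in [B s B]. *)
Lemma cell_down n s : N n -> simple s -> len (n * s)%g <= len n ->
  exists2 b, B b & dcoset n (n * b * s)%g.
Proof.
move=> Nn sS nsn; have [b Bb sbs] := simple_thick sS.
have Ns := simple_N sS; have sV := simpleV sS.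
have [|] := cell_r sV Ns Bb.
  rewrite mulgV => -[c [c' [Bc Bc' E]]]; case: sbs; rewrite E mulg1; exact: BM.
move=> [c [c' [Bc Bc' E]]].
have : dcoset (n * s * s^-1)%g (n * s * b * s^-1)%g.
  by apply: cell_up => //; [exact: NM|rewrite mulgK].
rewrite mulgK -(mulgA n) -(mulgA n) E => /(dcosetMr (BV Bc')).
by rewrite !groupE => nE; exists c.
Qed.

Lemma len_mulr_neq n s : N n -> simple s -> len (n * s)%g != len n.
Proof.
move=> Nn sS; apply/eqP => E.
have [b Bb nbs] : exists2 b, B b & dcoset n (n * b * s)%g.
  by apply: cell_down; rewrite // E.
have /dcoset_sym : dcoset (n * s)%g (n * b * s)%g by apply: cell_up; rewrite // E.
move=> /(dcoset_trans nbs)/dcoset_inj => /(_ Nn (NM Nn (simple_N sS))).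
by rewrite mulKg => /(simple_notT sS).
Qed.

Lemma cell_upP n s : N n -> simple s ->
  (forall b, B b -> dcoset (n * s)%g (n * b * s)%g) <-> len n < len (n * s)%g.
Proof.
move=> Nn sS; split=> [up|/ltnW up b]; last exact: cell_up.
rewrite ltnNge; apply/negP => /(cell_down Nn sS) [b Bb nbs].
have /dcoset_sym/(dcoset_trans nbs)/dcoset_inj := up b Bb.
by move=> /(_ Nn (NM Nn (simple_N sS))); rewrite mulKg => /(simple_notT sS).
Qed.

(** For [x] on the left, [n^-1 x n] has the form [s b s^-1], so it lies in [B] or in [B s B]. The
    second case would put [x n] both in [B n B] and in [B n s B]. *)
Lemma conjB_up n s : N n -> simple s -> len n < len (n * s)%g ->
  B `&` conj_by (n * s)%g B `<=` conj_by n B.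
Proof.
move=> Nn sS /(cell_upP Nn sS) up x [Bx [b Bb xE]].
have Ns := simple_N sS; pose y := (n^-1 * x * n)%g.
have yE : (y = s * b * s^-1)%g by rewrite /y -xE !groupE.
exists y; last by rewrite /y !groupE.
have [] := cell_r (simpleV sS) Ns Bb; rewrite -yE ?mulgV.
  by case=> c [c' [Bc Bc' ->]]; rewrite mulg1; exact: BM.
move=> [c [c' [Bc Bc' yE']]].
have /(dcosetMr Bc') : dcoset (n * s)%g (n * c * s)%g by exact: up.
have -> : (n * c * s * c' = x * n)%g.
  by rewrite -(mulgA n) -(mulgA n) -yE' /y !groupE.
have /dcoset_sym /[swap] /dcoset_trans /[apply] : dcoset n (x * n)%g.
  exact: dcosetMl (dcoset_refl _).
move=> /dcoset_inj; rewrite invgM mulgVK.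
by move=> /(_ (NM Nn Ns) Nn) /TV; rewrite invgK => /(simple_notT sS).
Qed.

(** Take [b0] in [B] with [s^-1 b0 s] outside [B]. Writing [n b0 s = c n s c'] factors it as
    [b0 = x y], with [x = n^-1 c n] and [y = s c' s^-1] both in [B]. Then [c = n x n^-1] lies in [B]
    and in [n B n^-1], but not in the conjugate of [B] by [n s]. *)
Lemma conjB_up_strict n s : N n -> simple s -> len n < len (n * s)%g ->
  ~ B `&` conj_by n B `<=` conj_by (n * s)%g B.
Proof.
move=> Nn sS up sub; have [b0 Bb0] := simple_thick (simpleV sS); apply.
rewrite invgK; have Ns := simple_N sS.
have /(cell_upP Nn sS) cup := up.
have [c [c' [Bc Bc' E]]] := cup _ Bb0.
pose x := (n^-1 * c * n)%g; pose y := (s * c' * s^-1)%g.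
have b0E : (b0 = x * y)%g.
  by apply: (mulgI n); apply: (mulIg s); rewrite E /x /y !groupE.
(* Otherwise [y] lies in [B s B], and [c^-1 n = n y b0^-1] lies both in [B n B] and in [B n s B]. *)
have By : B y.
  have [] := cell_r (simpleV sS) Ns Bc'.
    by rewrite mulgV => -[d [d' [Bd Bd' yE]]]; rewrite /y yE mulg1; exact: BM.
  move=> [d [d' [Bd Bd' yE]]].
  have : dcoset (n * s)%g (c^-1 * n)%g.
    have -> : (c^-1 * n = n * d * s * (d' * b0^-1))%g.
      have -> : (n * d * s * (d' * b0^-1) = n * (d * s * d' * b0^-1))%g by rewrite !mulgA.
      by rewrite -yE -/y b0E invgM mulVKg /x !groupE.
    by apply: dcosetMr; [exact: BM (BV Bb0)|exact: cup].
  move=> /dcoset_sym /(dcoset_trans (dcosetMl (BV Bc) (dcoset_refl n))) /dcoset_inj.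
  by move=> /(_ Nn (NM Nn Ns)); rewrite mulKg => /(simple_notT sS).
have Bx : B x by rewrite -[x](mulgK y) -b0E; exact: BM (BV By).
have [|d Bd dE] := sub c; first by split=> //; exists x => //; rewrite /x !groupE.
have -> : (s^-1 * b0 * s = d * c')%g.
  by rewrite b0E /x /y -dE !groupE.
exact: BM.
Qed.

End BNTheory.

(** * The longest element *)

Section LongestElement.
Variables (K : closedFieldType) (G : alg_group K).
Variables (B N U : set G) (S : set (set G)).
Hypothesis bn : split_BN_pair B N U S.

Local Notation T := (B `&` N).
Local Notation simple := (simple S).
Local Notation len := (len B N S).
Local Notation dcoset := (dcoset B).

Local Notation B1 := (B1 bn).
Local Notation BM := (BM bn).
Local Notation BV := (BV bn).
Local Notation N1 := (N1 bn).
Local Notation NM := (NM bn).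
Local Notation NV := (NV bn).
Local Notation TV := (TV bn).
Local Notation simple_N := (simple_N bn).

(** Maximality is only local here; [len_top] shows that such an element is the longest one. *)
Definition top_elt (w : G) : Prop :=
  N w /\ forall s, simple s -> len (w * s)%g < len w.

Lemma top_eltPn w : N w -> ~ top_elt w -> exists2 s, simple s & len w < len (w * s)%g.
Proof.
move=> Nw /not_andP [//|/existsNP [s /not_implyP [sS /negP]]].
rewrite -leqNgt => ws; exists s => //.
by rewrite ltn_neqAle eq_sym ws (len_mulr_neq bn).
Qed.

(** Otherwise ascents could be prolonged for ever, and the intersections of [B] with its conjugates
    along them would contradict [conj_by_chain]. *)
Lemma top_elt_ex : exists w, top_elt w.
Proof.
apply: contrapT => /forallNP noTop.
have step n : exists s, N n -> simple s /\ len n < len (n * s)%g.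
  have [Nn|nNn] := pselect (N n); last by exists 1%g => /nNn.
  by have [s sS ns] := top_eltPn Nn (noTop n); exists s.
have [h hP] := choice step.
pose u := fix u k := if k is k'.+1 then (u k' * h (u k'))%g else 1%g : G.
have Nu k : N (u k).
  elim: k => [|k IHk] /=; first exact: N1.
  by apply: (NM IHk); have [/simple_N] := hP _ IHk.
have [i|i] := conj_by_chain (bn_B bn).2 (u := u).
  by have [sS up] := hP _ (Nu i); exact: (conjB_up bn (Nu i) sS up).
by have [sS up] := hP _ (Nu i); exact: (conjB_up_strict bn (Nu i) sS up).
Qed.

(** [F] lists the products of subwords of a reduced word of [n]: each application of [cell_r] keeps
    or drops the next letter. That [F] depends neither on [m] nor on [b] is what later yields
    finiteness. *)
Lemma subwords n : N n -> exists F : seq G,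
  (forall v, v \in F -> N v /\ (T (n^-1 * v)%g \/ len v < len n)) /\
  forall m b, N m -> B b -> exists2 v, v \in F & dcoset (m * v)%g (m * b * n)%g.
Proof.
move: {2}(len n) (erefl (len n)) => q; elim: q n => [|q IHq] n nq Nn.
  exists [:: n]; split=> [v|m b Nm Bb].
    by rewrite inE => /eqP ->; split=> //; left; rewrite mulVg; exact: (T1 bn).
  exists n; rewrite ?inE//; have [Bn _] := len_eq0 bn Nn nq.
  have -> : (m * b * n = m * n * (n^-1 * b * n))%g by rewrite !groupE.
  by apply: (dcosetMr bn) (dcoset_refl bn _); exact: (BM (BM (BV Bn) Bb) Bn).
have [|s [n' [sS Nn' nE nn']]] := len_predr bn Nn; first by rewrite nq.
have [|F [FP FD]] := IHq n' _ Nn'; first by move: nn'; rewrite nq => -[].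
exists (map (fun v => v * s)%g F ++ F); split=> [v|m b Nm Bb].
  rewrite mem_cat => /orP [/mapP [{}v vF ->]|vF]; have [Nv n'v] := FP _ vF.
    split; first exact/NM/simple_N.
    case: n'v => [Tv|lv]; [left|right].
      have := TJV bn (simple_N sS) Tv; by rewrite nE !groupE.
    by rewrite nn' (leq_ltn_trans (len_mulr bn Nv sS)).
  split=> //; right; rewrite nn' ltnS; case: n'v => [Tv|/ltnW //].
  by rewrite -[v](mulVKg n') (lenT bn).
have [v vF [c [c' [Bc Bc' E]]]] := FD m b Nm Bb.
have [Nv _] := FP _ vF.
have E' : (m * b * n = c * (m * v * c' * s))%g by rewrite nE !mulgA E !mulgA.
have [|] := cell_r bn sS (NM Nm Nv) Bc' => /(dcosetMl bn Bc); rewrite -E'.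
  by exists (v * s)%g; rewrite ?mulgA// mem_cat (map_f (fun v => v * s)%g vF).
by exists v => //; rewrite mem_cat vF orbT.
Qed.

(** Induction on the length of [y]: every simple [s] shortens [w], so by [cell_down] each new letter
    can be absorbed without leaving [B w B]. *)
Lemma top_elt_absorb w y : top_elt w -> N y ->
  exists2 b, B b & dcoset w (w * b * y)%g.
Proof.
move=> [Nw wtop]; move: {2}(len y) (erefl (len y)) => q.
elim: q y => [|q IHq] y yq Ny.
  have [By _] := len_eq0 bn Ny yq; exists 1%g; rewrite ?mulg1; first exact: B1.
  exact: (dcosetMr bn) (dcoset_refl bn _).
have [|s [y' [sS Ny' yE yy']]] := len_predr bn Ny; first by rewrite yq.
have [|b Bb [c [c' [Bc Bc' E]]]] := IHq y' _ Ny'; first by move: yy'; rewrite yq => -[].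
have [d Bd wds] := cell_down bn Nw sS (ltnW (wtop s sS)).
(* The element of [B] needed between [w] and [s] has to stand before [y']; as [y' s] is longer than
   [y'], [cell_up] carries it there, as the factor [e]. *)
have : dcoset (y' * s)%g (y' * (c'^-1 * d) * s)%g.
  by apply: (cell_up bn) => //; [rewrite -yE yy'|exact: BM (BV Bc') Bd].
move=> [e [e' [Be Be' E']]]; exists (b * e)%g; first exact: BM.
have -> : (w * (b * e) * y = c * (w * d * s) * e'^-1)%g.
  apply: (mulIg e'); rewrite mulgVK.
  have -> : (w * (b * e) * y * e' = w * b * (e * (y' * s) * e'))%g by rewrite yE !mulgA.
  by rewrite -E' !mulgA E !groupE.
exact: (dcosetM bn) (BV Be') _.
Qed.

(** By absorption [y] lies in [B w^-1 c w B] for some [c] in [B], and [subwords] places [w^-1 c w]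
    in a cell [B w^-1 v B]; uniqueness of cells identifies [y] with [w^-1 v] modulo [T]. *)
Lemma top_elt_cover w : top_elt w -> exists F : seq G,
  (forall v, v \in F -> N v /\ (T (w^-1 * v)%g \/ len v < len w)) /\
  forall y, N y -> exists2 v, v \in F & T (v^-1 * w * y)%g.
Proof.
move=> wtop; have [Nw _] := wtop; have [F [FP FD]] := subwords Nw.
exists F; split=> // y Ny.
have [b Bb [c [c' [Bc Bc' E]]]] := top_elt_absorb wtop Ny.
have [v vF wv] := FD (w^-1)%g c (NV Nw) Bc; exists v => //.
have [Nv _] := FP v vF.
suff /(dcoset_inj bn) : dcoset (w^-1 * v)%g y.
  by rewrite invgM invgK; apply=> //; exact: NM (NV Nw) Nv.
have -> : (y = b^-1 * (w^-1 * c * w) * c')%g.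
  have -> : (b^-1 * (w^-1 * c * w) * c' = b^-1 * w^-1 * (c * w * c'))%g by rewrite !mulgA.
  by rewrite -E !groupE.
by apply: (dcosetM bn) => //; exact: BV.
Qed.

Lemma finite_Weyl : finite_set (cosets N T).
Proof.
have [w wtop] := top_elt_ex; have [F [FP FD]] := top_elt_cover wtop.
apply: (@sub_finite_set _ _ ((fun v => lcoset (w^-1 * v)%g T) @` [set` F])).
  move=> _ [y Ny <-]; have [v vF Tv] := FD y Ny.
  exists v => //; apply/seteqP; split=> _ [t Tt <-].
    exists ((v^-1 * w * y)^-1 * t)%g; first exact: (TM bn) (TV Tv) Tt.
    by rewrite !groupE.
  exists (v^-1 * w * y * t)%g; first exact: (TM bn).
  by rewrite !groupE.
exact/finite_image/finite_seq.
Qed.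

(** Covering [w^-1 y] instead of [y] shows that [y] itself is, modulo [T], a subword of [w]. *)
Lemma len_top w y : top_elt w -> N y -> T (w^-1 * y)%g \/ len y < len w.
Proof.
move=> wtop Ny; have [Nw _] := wtop; have [F [FP FD]] := top_elt_cover wtop.
have [v vF] := FD _ (NM (NV Nw) Ny); rewrite mulgA mulgK => Tvy.
have [Nv [Tv|lv]] := FP v vF; [left|right].
  by rewrite -[y](mulVKg v) mulgA; exact: (TM bn).
by rewrite -[y](mulVKg v) (lenT bn).
Qed.

(** A second locally maximal class would be both shorter and longer than that of [w]. *)
Lemma non_top_ascent w n : top_elt w -> N n -> ~ T (w^-1 * n)%g ->
  exists2 s, simple s & len n < len (n * s)%g.
Proof.
move=> wtop Nn wn; apply: top_eltPn => // ntop.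
have [//|nw] := len_top wtop Nn; have [Nw _] := wtop.
have [Tnw|] := len_top ntop Nw; last by rewrite ltnNge ltnW.
by apply: wn; rewrite -[(_ * n)%g]invgK invgM invgK; exact: TV.
Qed.

(** Induction on [len w - len n], descending from the longest element along ascents. *)
Lemma ascent_ind w (P : G -> Prop) : top_elt w ->
    (forall n, N n -> T (w^-1 * n)%g -> P n) ->
    (forall n s, N n -> simple s -> len n < len (n * s)%g -> P (n * s)%g -> P n) ->
  forall n, N n -> P n.
Proof.
move=> wtop Pw Pup n; have [q] := ubnP (len w - len n).
elim: q n => // q IHq n nq Nn.
have [Tn|/(non_top_ascent wtop Nn) [s sS ns]] := pselect (T (w^-1 * n)%g); first exact: Pw.
have Nns := NM Nn (simple_N sS).
apply: (Pup n s) => //; apply: IHq => //; apply: leq_trans _ (ltnSE nq).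
apply: ltn_sub2l => //; case: (len_top wtop Nns) => [Tns|]; last exact: ltn_trans.
by move: ns; rewrite -{1}[(n * s)%g](mulVKg w) (lenT bn)//; case: wtop.
Qed.

(** By [conjB_up] and descending induction, the left side lies in [n B n^-1] for all [n] in [N];
    axiom (vi) says that these meet in [T]. *)
Lemma conjB_top w : top_elt w -> B `&` conj_by w B `<=` T.
Proof.
move=> wtop x [Bx xw]; rewrite -(bn_bigcap bn).
have [Nw _] := wtop.
move=> n Nn; apply: (ascent_ind (P := fun n => conj_by n B x)) wtop _ _ n Nn => [n Nn Tn|n s Nn sS ns xns].
  case: xw => b Bb <-; exists ((w^-1 * n)^-1 * b * (w^-1 * n))%g.
    by case: Tn => Bn _; apply: BM => //; exact: BM (BV Bn) Bb.
  by rewrite !groupE.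
exact: (conjB_up bn Nn sS ns).
Qed.

(** The union [X] of the cells is a subgroup containing [B] and [N], which generate [G]; closure
    under products comes from multiplying a cell by one simple letter at a time. *)
Lemma Bruhat g : exists2 n, N n & dcoset n g.
Proof.
have mulN m n h : N m -> N n -> dcoset n h -> exists2 n', N n' & dcoset n' (h * m)%g.
  move: {2}(len m) (erefl (len m)) => q.
  elim: q m n h => [|q IHq] m n h mq Nm Nn nh.
    have [Bm _] := len_eq0 bn Nm mq.
    by exists n => //; exact: (dcosetMr bn).
  have [|s [m' [sS Nm' mE mm']]] := len_predl bn Nm; first by rewrite mq.
  have qm' : len m' = q by move: mm'; rewrite mq => -[].
  rewrite mE mulgA; case: nh => c [c' [Bc Bc' ->]].
  have -> : (c * n * c' * s = c * (n * c' * s))%g by rewrite !mulgA.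
  have [|] := cell_r bn sS Nn Bc' => /(dcosetMl bn Bc).
    by apply: IHq => //; exact/NM/simple_N.
  exact: IHq.
pose X : set G := [set g | exists2 n, N n & dcoset n g].
have : smallest (@is_subgroup G) (B `|` N) g by rewrite (bn_gen bn).
move/(_ X); apply; split; first split.
- by exists 1%g; [exact: N1|exact: (dcoset_refl bn)].
- move=> h h' [n Nn nh] [n' Nn' [c [c' [Bc Bc' ->]]]].
  have [m Nm mh] := mulN n' n (h * c)%g Nn' Nn (dcosetMr bn Bc nh).
  by exists m => //; rewrite !mulgA; exact: (dcosetMr bn).
- by move=> h [n Nn nh]; exists (n^-1)%g; [exact: NV|exact: (dcosetV bn)].
move=> h [Bh|Nh]; last by exists h => //; exact: (dcoset_refl bn).
exists 1%g; first exact: N1.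
by rewrite -[h]mul1g; exact: (dcosetMr bn Bh (dcoset_refl bn _)).
Qed.

End LongestElement.

Local Open Scope ring_scope.

(** * Universal properties *)

Section FreeLift.
Variables (k : fieldType) (X : choiceType) (V : lmodType k).

Definition free_lift (f : X -> V) : {freeg X / k} -> V := fglift f.

Lemma free_lift_linear f : linear (free_lift f).
Proof.
have liftB : {morph free_lift f : u v / u - v} := lift_is_additive f.
have lift0 : free_lift f 0 = 0 by rewrite -[X in free_lift f X](subrr 0) liftB subrr.
have liftD : {morph free_lift f : u v / u + v}.
  move=> u v; have liftN : free_lift f (- v) = - free_lift f v.
    by rewrite -[in LHS]sub0r liftB lift0 sub0r.
  by rewrite -[v in LHS]opprK liftB liftN opprK.
have lift_sum (I : Type) (r : seq I) (F : I -> {freeg X / k}) :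
    free_lift f (\sum_(i <- r) F i) = \sum_(i <- r) free_lift f (F i).
  exact: (big_morph _ liftD lift0).
move=> a u v; rewrite liftD; congr (_ + _).
rewrite [a *: u]/(fgscale a u) lift_sum -[u in RHS]freeg_sumE lift_sum.
rewrite scaler_sumr; apply: eq_bigr => x _.
by rewrite /free_lift !liftU scalerA.
Qed.

HB.instance Definition _ f :=
  GRing.isLinear.Build k {freeg X / k} V *:%R (free_lift f) (free_lift_linear f).

Lemma free_liftU f x : free_lift f << x >> = f x.
Proof. by rewrite /free_lift liftU scale1r. Qed.

End FreeLift.

Lemma lspan_sub (k : fieldType) (V : lmodType k) (X Y : set V) :
  is_submod Y -> X `<=` Y -> lspan X `<=` Y.
Proof. by move=> Ysub XY u; apply. Qed.

Lemma sub_lspan (k : fieldType) (V : lmodType k) (X : set V) : X `<=` lspan X.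
Proof. by move=> x Xx Y [_]; exact. Qed.

Section TensorLift.
Variables (k : fieldType) (V W : lmodType k) (A : set ((V -> V) * (W -> W))).

Lemma tens_eq u v : tensor_rel A (u - v) -> lproj (tensor_rel A) u = lproj (tensor_rel A) v.
Proof. by move=> uv; apply/eqP/lquotP; exact: sub_lspan. Qed.

Lemma tens_linl w : linear (fun v => tens A v w).
Proof.
move=> a v v'; rewrite /tens (tens_eq (TensorDl A _ _ _)) linearD; congr (_ + _).
by rewrite /= (tens_eq (TensorZl A _ _ _)) linearZ.
Qed.

Lemma tens_linr v : linear (tens A v).
Proof.
move=> a w w'; rewrite /tens (tens_eq (TensorDr A _ _ _)) linearD; congr (_ + _).
by rewrite /= (tens_eq (TensorZr A _ _ _)) linearZ.
Qed.

Lemma tensZl (a : k) v w : tens A (a *: v) w = a *: tens A v w.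
Proof. exact: (scalable_linear (tens_linl w)). Qed.

Lemma tensZr (a : k) v w : tens A v (a *: w) = a *: tens A v w.
Proof. exact: (scalable_linear (tens_linr v)). Qed.

Lemma tens0l w : tens A 0 w = 0.
Proof. by rewrite -(scale0r 0) tensZl scale0r. Qed.

Lemma tens0r v : tens A v 0 = 0.
Proof. by rewrite -(scale0r 0) tensZr scale0r. Qed.

Lemma tens_balanced p v w : A p -> tens A (p.1 v) w = tens A v (p.2 w).
Proof. by move=> Ap; apply/tens_eq/TensorA. Qed.

Lemma tensor_lift (Z : lmodType k) (beta : V -> W -> Z) :
    (forall w, linear (beta^~ w)) -> (forall v, linear (beta v)) ->
    (forall p v w, A p -> beta (p.1 v) w = beta v (p.2 w)) ->
  exists L : {linear tensor A -> Z}, forall v w, L (tens A v w) = beta v w.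
Proof.
move=> linl linr bal; pose F : {linear {freeg (V * W) / k} -> Z} := free_lift (fun p => beta p.1 p.2).
have F0 : lspan (tensor_rel A) `<=` [set u | F u = 0].
  apply: lspan_sub => [|u].
    split=> [|a u v Fu Fv]; first exact: linear0.
    by rewrite /mkset linearP [F u]Fu [F v]Fv scaler0 addr0.
  move=> uA; rewrite /mkset; apply/eqP; case: uA => [v v' w|v w w'|a v w|a v w|p v w Ap];
    rewrite linearB subr_eq0 ?linearD ?linearZ /= !free_liftU /=; apply/eqP.
  - by have := linl w 1 v v'; rewrite !scale1r.
  - by have := linr v 1 w w'; rewrite !scale1r.
  - exact: (scalable_linear (linl w)).
  - exact: (scalable_linear (linr v)).
  - exact: bal.
pose L (x : tensor A) := F (repr x).
have LE u : L (lproj _ u) = F u.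
  apply/eqP; rewrite -subr_eq0 -linearB; apply/eqP/F0.
  by apply/lquotP; rewrite reprK.
have Llin : linear L.
  move=> a; elim/quotW=> u; elim/quotW=> v.
  by rewrite -!/(lproj _ _) -linearP !LE linearP.
pose Lm := GRing.isLinear.Build k (tensor A) Z *:%R L Llin.
pose LL : {linear tensor A -> Z} := HB.pack L Lm.
by exists LL => v w; rewrite /= LE [LHS]free_liftU.
Qed.

End TensorLift.

Section InducedLift.
Variables (k : fieldType) (gT : groupType) (H : set gT) (V : rep k H).

Definition ind_tens (g : gT) (v : V) : Ind V := tens (@ind_rel _ _ _ V) << g >> v.

Lemma Ind_ind (P : Ind V -> Prop) :
  P 0 -> (forall a g v x, P x -> P (a *: ind_tens g v + x)) -> forall x, P x.
Proof.
move=> P0 PD; elim/tensor_ind=> [//|a u v x Px].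
elim/freeg_ind: u a x Px => [|b g u IHu] a x Px.
  by rewrite tens0l scaler0 add0r.
by rewrite tens_linl scalerDr scalerA -addrA; apply: PD; exact: IHu.
Qed.

Lemma ind_tensM g h v : H h -> ind_tens (g * h)%g v = ind_tens g (rep_act V h v).
Proof.
move=> Hh; pose p := (grp_rmul k h : {freeg gT / k} -> {freeg gT / k}, rep_act V h : V -> V).
have Ap : @ind_rel _ _ _ V p by exists h.
have -> : ind_tens (g * h)%g v = tens (@ind_rel _ _ _ V) (p.1 << g >>) v.
  by rewrite /= free_mapU.
exact: tens_balanced.
Qed.

Lemma ind_lift (Z : lmodType k) (f : gT -> V -> Z) :
    (forall g, linear (f g)) ->
    (forall g h v, H h -> f (g * h)%g v = f g (rep_act V h v)) ->
  exists L : {linear Ind V -> Z}, forall g v, L (ind_tens g v) = f g v.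
Proof.
move=> flin fH; pose beta (x : {freeg gT / k}) v := free_lift (f^~ v) x.
have [w|x|_ x w [h Hh <-]|L LE] := @tensor_lift _ _ _ (@ind_rel _ _ _ V) Z beta.
- exact: free_lift_linear.
- move=> a v w; rewrite /beta; elim/freeg_ind: x => [|b g u IHu].
    by rewrite !linear0 addr0.
  rewrite !linearP /= !free_liftU IHu flin.
  by rewrite !scalerDr !scalerA [b * a]mulrC addrACA.
- rewrite /beta /=; elim/freeg_ind: x => [|b g u IHu]; first by rewrite !linear0.
  by rewrite !linearP /= IHu !free_mapU !free_liftU fH.
- by exists L => g v; rewrite LE /beta free_liftU.
Qed.

End InducedLift.

(** The set [p] selects one index from each pair, so terms cancel two by two. This also covers
    characteristic 2, where a sum equal to its opposite need not vanish. *)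
Lemma fsum_involution (I : choiceType) (V : zmodType) (D p : set I) (sigma : I -> I)
    (F : I -> V) : finite_set D ->
    (forall i, D i -> [/\ D (sigma i), sigma (sigma i) = i,
       p i <-> ~ p (sigma i) & F (sigma i) = - F i]) ->
  \sum_(i \in D) F i = 0.
Proof.
move=> Dfin sP; rewrite (fsbigID p)//=.
rewrite (@reindex_fsbig _ _ _ _ _ sigma (D `&` p) (D `&` ~` p)); last first.
  split=> [i [Di pi]|i j|i [Di pi]].
  - by have [Ds _ [ps _] _] := sP i Di; split=> //; exact: ps.
  - by rewrite !inE => -[Di _] [Dj _] sij; have [_ <- _ _] := sP i Di; have [_ <- _ _] := sP j Dj; rewrite sij.
  - have [Ds ss [_ ps] _] := sP i Di; exists (sigma i) => //; split=> //.
    by apply: contrapT => /ps.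
rewrite -fsbig_split; last exact: finite_setIl.
by apply: fsbig1 => i [/sP [_ _ _ ->] _]; exact: subrr.
Qed.

(** * The permutation module [k[G/B]] and its coefficients *)

Section TrivialInduction.
Variables (k : fieldType) (G : groupType) (B : set G).
Hypothesis Bgrp : is_subgroup B.

Local Notation M := (Ind (triv_rep k B)).

Definition tr_gen (g : G) : M := ind_tens (V := triv_rep k B) g (1 : k^o).

Lemma tr_genM g b : B b -> tr_gen (g * b)%g = tr_gen g.
Proof. by move=> Bb; rewrite /tr_gen ind_tensM. Qed.

Lemma tr_gen_act g h : rep_act M g (tr_gen h) = tr_gen (g * h)%g.
Proof. by rewrite /tr_gen /ind_tens [LHS]ind_actE /= free_mapU. Qed.

Lemma tr_gen_ind (P : M -> Prop) :
  P 0 -> (forall a g x, P x -> P (a *: tr_gen g + x)) -> forall x, P x.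
Proof.
move=> P0 PD; apply: Ind_ind => // a g v x Px.
have -> : ind_tens (V := triv_rep k B) g v = v *: tr_gen g.
  apply: etrans (tensZr (@ind_rel _ _ _ (triv_rep k B)) v << g >> (1 : k^o)).
  by congr tens; exact/esym/mulr1.
by rewrite scalerA; exact: PD.
Qed.

Lemma tr_gen_lift (Z : lmodType k) (f : G -> Z) : (forall g b, B b -> f (g * b)%g = f g) ->
  exists L : {linear M -> Z}, forall g, L (tr_gen g) = f g.
Proof.
move=> fB; have [g a u v|g b v Bb|L LE] := @ind_lift k G B (triv_rep k B) Z (fun g v => (v : k) *: f g).
- by rewrite scalerDl scalerA.
- by rewrite fB.
- by exists L => g; rewrite LE scale1r.
Qed.

(** For [B] a subgroup, the union of the cosets [gB] meeting [X]; its indicator function is right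
    [B]-invariant, hence defined on [G/B]. *)
Definition satur (X : set G) : set G := [set g | exists2 b, B b & X (g * b)%g].

Lemma saturM X g b : B b -> satur X (g * b)%g <-> satur X g.
Proof.
have [_ BM BV] := Bgrp.
move=> Bb; split=> -[c Bc Xc].
  by exists (b * c)%g; rewrite ?mulgA//; exact: BM.
by exists (b^-1 * c)%g; rewrite ?mulgA ?mulgK//; exact: BM (BV _ _) _.
Qed.

Lemma coset_coef_ex (X : set G) : exists L : {linear M -> k^o},
  forall g, L (tr_gen g) = (`[< satur X g >])%:R.
Proof.
apply: tr_gen_lift => g b Bb; congr (_ _)%:R; apply/asboolP/asboolP; by move=> /(saturM X g Bb).
Qed.

(** The sum of the coefficients over all cosets [gB] that meet [X]. For [X = [set g]] it is the
    coefficient at [gB]; for [X = g P_s], a coefficient of the image in [k[G/P_s]]. *)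
Definition coset_coef (X : set G) : {linear M -> k^o} := sval (cid (coset_coef_ex X)).

Lemma coset_coefE X g : coset_coef X (tr_gen g) = (`[< satur X g >])%:R.
Proof. exact: (svalP (cid (coset_coef_ex X))). Qed.

Lemma coset_coef_act X g v : coset_coef X (rep_act M g v) = coset_coef [set h | X (g * h)%g] v.
Proof.
elim/tr_gen_ind: v => [|a h x IHx]; first by rewrite !linear0.
rewrite !linearP IHx tr_gen_act !coset_coefE; congr (_ *: (_ _)%:R + _).
by apply/asboolP/asboolP => -[b Bb Xb]; exists b; rewrite //= ?mulgA// -mulgA.
Qed.

Lemma coset_coef_set1M g b v :
  B b -> coset_coef [set (g * b)%g] v = coset_coef [set g] v.
Proof.
have [_ BM BV] := Bgrp.
move=> Bb; elim/tr_gen_ind: v => [|a h x IHx]; first by rewrite !linear0.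
rewrite !linearP IHx !coset_coefE; congr (_ *: (_ _)%:R + _).
apply/asboolP/asboolP => -[c Bc /= hc].
  by exists (c * b^-1)%g; rewrite /= ?mulgA ?hc ?mulgK//; apply: BM => //; exact: BV.
by exists (c * b)%g; rewrite /= ?mulgA ?hc//; exact: BM.
Qed.

Lemma coset_coef_eq0 v : (forall g, coset_coef [set g] v = 0) -> v = 0.
Proof.
have [B1 BM BV] := Bgrp.
(* [r g] depends only on the coset [gB], so [gB -> r g] embeds [k[G/B]] into [kG], where an element
   with zero coefficients vanishes. *)
pose r g := xget 1%g (lcoset g B).
have rB g b : B b -> r (g * b)%g = r g.
  move=> Bb; congr xget; apply/seteqP; split=> _ [c Bc <-].
    by exists (b * c)%g; rewrite ?mulgA//; exact: BM.
  by exists (b^-1 * c)%g; rewrite ?mulgA ?mulgK//; apply: BM => //; exact: BV.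
have rP g : exists2 b, B b & r g = (g * b)%g.
  have : (lcoset g B) (r g) by apply: (@xgetI _ _ _ g); exists 1%g; rewrite ?mulg1.
  by case=> b Bb <-; exists b.
have [L LE] : exists L : {linear M -> {freeg G / k}}, forall g, L (tr_gen g) = << r g >>.
  by apply: tr_gen_lift => g b Bb; rewrite rB.
have Lcoef h x : coeff h (L x) = (r h == h)%:R * coset_coef [set h] x.
  elim/tr_gen_ind: x => [|a g x IHx]; first by rewrite !linear0 coeff0 mulr0.
  rewrite !linearP /= coeffD coeffZ IHx LE coeffU mul1r mulrDr coset_coefE.
  rewrite [X in _ = X + _]mulrCA; congr (_ * _ + _).
  have [rgh|rgh] := eqVneq (r g) h.
    have [b Bb rgE] := rP g; rewrite -{1}rgh rgE rB// rgh eqxx mul1r.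
    by rewrite (asboolT (P := satur _ _))//; exists b => //=; rewrite -rgE.
  have [rhh|_] := eqVneq (r h) h; last by rewrite mul0r.
  rewrite mul1r asboolF// => -[b Bb /= gbh].
  by move: rgh; rewrite -(rB g b Bb) gbh rhh eqxx.
have LK x : free_lift tr_gen (L x) = x.
  elim/tr_gen_ind: x => [|a g x IHx]; first by rewrite !linear0.
  rewrite !linearP /= IHx LE free_liftU.
  by have [b Bb ->] := rP g; rewrite tr_genM.
move=> v0; rewrite -[v]LK (_ : L v = 0) ?linear0//.
by apply/eqP/freeg_eqP => h; rewrite Lcoef v0 mulr0 coeff0.
Qed.

(** [L] projects onto the span of the cosets meeting [X]: it preserves [coset_coef X], and the
    hypothesis says that it kills [v]. *)
Lemma coset_coef_eq0_sub (X : set G) v :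
  (forall g, satur X g -> coset_coef [set g] v = 0) -> coset_coef X v = 0.
Proof.
have [L LE] : exists L : {linear M -> M},
    forall g, L (tr_gen g) = if `[< satur X g >] then tr_gen g else 0.
  apply: tr_gen_lift => g b Bb; rewrite tr_genM//; congr (if _ then _ else _).
  by apply/asboolP/asboolP; move=> /(saturM X g Bb).
have LX x : coset_coef X (L x) = coset_coef X x.
  elim/tr_gen_ind: x => [|a g x IHx]; first by rewrite !linear0.
  rewrite !linearP IHx LE; congr (_ *: _ + _); case: ifPn => // gX.
  by rewrite linear0 coset_coefE (negbTE gX).
have Lg g x : coset_coef [set g] (L x) = (`[< satur X g >])%:R * coset_coef [set g] x.
  elim/tr_gen_ind: x => [|a h x IHx]; first by rewrite !linear0 mulr0.
  rewrite !linearP IHx LE /= mulrDr [X in _ = X + _]mulrCA; congr (_ * _ + _).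
  have [gh|gh] := pselect (satur [set g] h); last first.
    by rewrite coset_coefE (asboolF gh) mulr0; case: ifP => _; rewrite ?linear0// coset_coefE asboolF.
  have <- : `[< satur X h >] = `[< satur X g >].
    by case: gh => b Bb /= <-; apply/asboolP/asboolP; move=> /(saturM X h Bb).
  by case: ifP => _; rewrite ?mul1r// mul0r linear0.
move=> v0; rewrite -LX (_ : L v = 0) ?linear0//; apply: coset_coef_eq0 => g.
rewrite Lg; have [gX|gX] := pselect (satur X g); first by rewrite v0// mulr0.
by rewrite asboolF// mul0r.
Qed.

End TrivialInduction.

(** * The Steinberg module *)

Section Steinberg.
Variables (K : closedFieldType) (G : alg_group K).
Variables (B N U : set G) (S : set (set G)).
Hypothesis bn : split_BN_pair B N U S.
Variable k : fieldType.

Local Notation T := (B `&` N).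
Local Notation simple := (simple S).
Local Notation len := (len B N S).
Local Notation dcoset := (dcoset B).
Local Notation M := (Ind (triv_rep k B)).
Local Notation tr_gen := (tr_gen k B).
Local Notation coset_coef := (coset_coef k (bn_B bn).1).
Local Notation e := (steinberg_vec k B N S).
Local Notation gens := (@steinberg_gens k K G B N U S).

Local Notation B1 := (B1 bn).
Local Notation BM := (BM bn).
Local Notation BV := (BV bn).
Local Notation N1 := (N1 bn).
Local Notation NM := (NM bn).
Local Notation NV := (NV bn).
Local Notation TV := (TV bn).
Local Notation simple_N := (simple_N bn).

Lemma UB u : U u -> B u.
Proof.
have [_ _ _ TUB] := bn_B_semidirect bn => Uu; rewrite -TUB.
by exists 1%g; [exact: (T1 bn)|exists u; rewrite ?mul1g].
Qed.
Lemma U1 : U 1%g. Proof. by have [[]] := bn_U bn. Qed.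
Lemma UM g h : U g -> U h -> U (g * h)%g.
Proof. by have [[_ H _] _] := bn_U bn; exact: H. Qed.
Lemma UV g : U g -> U (g^-1)%g.
Proof. by have [[_ _ H] _] := bn_U bn; exact: H. Qed.
Lemma UT1 g : U g -> T g -> g = 1%g.
Proof.
move=> Ug Tg; have [_ _ TU _] := bn_B_semidirect bn.
by have : (T `&` U) g by []; rewrite TU.
Qed.

Lemma BUT b : B b -> exists u t, [/\ U u, T t & b = (u * t)%g].
Proof.
move=> Bb; have [_ [_ _ UN] _ TUB] := bn_B_semidirect bn.
have [t Tt [u Uu <-]] : set_mul T U b by rewrite TUB.
exists (t * u * t^-1)%g, t; split=> //; last by rewrite mulgVK.
by rewrite -(UN t (TB Tt)); exists u.
Qed.

Lemma coset_1trE n : N n -> coset_1tr k B (lcoset n T) = tr_gen n.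
Proof.
move=> Nn; rewrite /coset_1tr -[LHS]/(tr_gen _).
have : (lcoset n T) (xget 1%g (lcoset n T)).
  by apply: (@xgetI _ _ _ n); exists 1%g; rewrite ?mulg1//; exact: (T1 bn).
by case=> t [Bt _] <-; rewrite tr_genM.
Qed.

(* g P_s, with P_s the minimal parabolic subgroup B `|` B s B. *)
Definition pcoset (g s : G) : set G := [set h | B (g^-1 * h)%g \/ dcoset s (g^-1 * h)%g].

Lemma pcosetM g s h b : B b -> pcoset g s h -> pcoset g s (h * b)%g.
Proof.
rewrite /pcoset /= mulgA => Bb [Bgh|]; first by left; exact: BM.
by right; exact: (dcosetMr bn).
Qed.

Lemma pcoset_simple g s h : simple s -> pcoset g s h -> pcoset g s (h * s)%g.
Proof.
rewrite /pcoset /= mulgA => sS [Bgh|[c [c' [Bc Bc' ->]]]].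
  by right; exact: (dcosetMl bn) (dcoset_refl bn _).
have -> : (c * s * c' * s = c * (s * c' * s))%g by rewrite !mulgA.
have [|] := cell_r bn sS (simple_N sS) Bc' => /(dcosetMl bn Bc); last by right.
case=> d [d' [Bd Bd' ->]]; left; apply: (BM _ Bd'); apply: (BM Bd).
by case: (simple_sqr bn sS).
Qed.

Lemma satur_pcoset g s h : satur B (pcoset g s) h <-> pcoset g s h.
Proof.
split=> [[b Bb]|gh]; last by exists 1%g; rewrite ?mulg1//; exact: B1.
by move=> /(pcosetM (BV Bb)); rewrite mulgK.
Qed.

(** The common kernel of the maps [k[G/B] -> k[G/P_s]], coefficient by coefficient. *)
Definition in_St (v : M) : Prop := forall g s, simple s -> coset_coef (pcoset g s) v = 0.

Lemma in_St_submod : is_submod in_St.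
Proof.
split=> [g s sS|a u v u0 v0 g s sS]; first exact: linear0.
by rewrite linearP u0// v0// addr0 scaler0.
Qed.

Lemma in_St_act g v : in_St v -> in_St (rep_act M g v).
Proof.
move=> v0 h s sS; rewrite (coset_coef_act (bn_B bn).1) -[RHS](v0 (g^-1 * h)%g s sS).
by congr (coset_coef _ _); apply/funext => x; rewrite /pcoset /= invgM invgK !mulgA.
Qed.

Lemma linear_fsum (V W : lmodType k) (L : {linear V -> W}) (I : choiceType)
    (D : set I) (F : I -> V) : finite_set D ->
  L (\sum_(i \in D) F i) = \sum_(i \in D) L (F i).
Proof. by move=> Dfin; rewrite !fsbig_finite// linear_sum. Qed.

(** Right multiplication by [s] pairs the terms of [e]: the lengths of [n] and [n s] differ by one,
    so the signs are opposite, and [g P_s] contains both elements or neither. *)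
Lemma steinberg_in_St : in_St e.
Proof.
move=> g s sS; have Ns := simple_N sS.
have Dfin := finite_Weyl bn.
rewrite /steinberg_vec linear_fsum//.
pose sigma (w : set G) : set G := [set (x * s)%g | x in w].
have sigmaE n : N n -> sigma (lcoset n T) = lcoset (n * s)%g T.
  move=> Nn; apply/seteqP; split=> [_ [_ [t Tt <-] <-]|_ [t Tt <-]].
    by exists (s^-1 * t * s)%g; rewrite ?groupE//; exact: (TJV bn).
  exists (n * (s * t * s^-1))%g; last by rewrite !groupE.
  by exists (s * t * s^-1)%g => //; exact: (TJ bn).
apply: (@fsum_involution _ _ _
  [set w | (coset_length T S w < coset_length T S (sigma w))%N] sigma) => // w [n Nn <-].
have ss : lcoset (n * s * s)%g T = lcoset n T.
  have Tss := simple_sqr bn sS.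
  apply/seteqP; split=> _ [t Tt <-].
    by exists (s * s * t)%g; rewrite ?mulgA//; exact: (TM bn).
  exists ((s * s)^-1 * t)%g; last by rewrite !groupE.
  exact: (TM bn (TV Tss)).
have Nns := NM Nn Ns.
rewrite !sigmaE// ss; split=> //; first by exists (n * s)%g.
  rewrite /= !sigmaE// ss -/(len n) -/(len (n * s)%g).
  have := len_mulr_neq bn Nn sS; case: ltngtP => // _ _.
rewrite !linearZ /= !coset_1trE// !(coset_coefE _ (bn_B bn).1).
have -> : `[< satur B (pcoset g s) (n * s)%g >] = `[< satur B (pcoset g s) n >].
  apply/asboolP/asboolP => /satur_pcoset /(pcoset_simple sS) H; apply/satur_pcoset => //.
  move: H => /(pcosetM (BV (TB (simple_sqr bn sS)))).
  by rewrite -(mulgA n) mulgK.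
rewrite scalerN -scaleNr; congr (_ *: _).
rewrite -/(len n) -/(len (n * s)%g).
have up := len_mulr bn Nn sS; have down := len_mulr_ge bn Nn sS.
have := len_mulr_neq bn Nn sS; rewrite neq_ltn => /orP [lt|lt].
  have -> : len n = (len (n * s)%g).+1 by apply/eqP; rewrite eqn_leq down.
  by rewrite exprS mulN1r opprK.
have -> : len (n * s)%g = (len n).+1 by apply/eqP; rewrite eqn_leq up.
by rewrite exprS mulN1r.
Qed.

(** * The big cell and its coordinates in [U] *)

Variable w0 : G.
Hypothesis w0top : top_elt B N S w0.

Lemma Nw0 : N w0. Proof. by case: w0top. Qed.

(** [U] acts freely on the big cell: [u^-1 u'] lies in [U] and in [w0 B w0^-1], hence in [T], which
    meets [U] trivially. *)
Lemma bigcell_uniq u u' g : U u -> U u' ->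
  B (w0^-1 * (u^-1 * g))%g -> B (w0^-1 * (u'^-1 * g))%g -> u = u'.
Proof.
move=> Uu Uu' Bu Bu'.
suff uu : (u^-1 * u' = 1)%g by rewrite -(mulg1_eq uu) invgK.
have Uuu' : U (u^-1 * u')%g by exact: UM (UV Uu) Uu'.
apply: (UT1 Uuu'); apply: (conjB_top bn w0top); split; first exact: UB.
exists (w0^-1 * (u^-1 * g) * (w0^-1 * (u'^-1 * g))^-1)%g; first exact: BM (BV Bu').
by rewrite !groupE.
Qed.

Lemma bigcellP g : dcoset w0 g -> exists u b, [/\ U u, B b & g = (u * w0 * b)%g].
Proof.
move=> [c [c' [/BUT [u [t [Uu Tt ->]]] Bc' ->]]].
exists u, (w0^-1 * t * w0 * c')%g; split=> //; last by rewrite !groupE.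
by apply: BM => //; case: (TJV bn Nw0 Tt).
Qed.

(** The [u] with [g] in [u w0 B]; the value off the big cell is a dummy. *)
Definition bigcell_U (g : G) : G := xget 1%g [set u | U u /\ B (w0^-1 * (u^-1 * g))%g].

Lemma bigcell_UE u b : U u -> B b -> bigcell_U (u * w0 * b)%g = u.
Proof.
move=> Uu Bb; have Bu : B (w0^-1 * (u^-1 * (u * w0 * b)))%g by rewrite !groupE.
by apply: xget_unique => // u' [Uu' Bu']; exact: bigcell_uniq Bu' Bu.
Qed.

Lemma bigcell_coord_ex : exists L : {linear M -> {freeg G / k}},
  forall g, L (tr_gen g) = if `[< dcoset w0 g >] then << bigcell_U g >> else 0.
Proof.
apply: tr_gen_lift => g b Bb.
have -> : `[< dcoset w0 (g * b)%g >] = `[< dcoset w0 g >].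
  apply/asboolP/asboolP; last exact: (dcosetMr bn).
  by move=> /(dcosetMr bn (BV Bb)); rewrite mulgK.
case: asboolP => // /bigcellP [u [c [Uu Bc ->]]].
by rewrite -(mulgA (u * w0)%g) !bigcell_UE//; exact: BM.
Qed.

(** The projection of [k[G/B]] onto the span of the big cell, which is identified with [kU] inside
    [kG] through [u w0 B -> u]. *)
Definition bigcell_coord : {linear M -> {freeg G / k}} := sval (cid bigcell_coord_ex).
Local Notation Lam := bigcell_coord.

Lemma bigcell_coordE g :
  Lam (tr_gen g) = if `[< dcoset w0 g >] then << bigcell_U g >> else 0.
Proof. exact: (svalP (cid bigcell_coord_ex)). Qed.

(** Expresses that the image of [Lam] lies in [kU], a subspace of [kG] that gets no type of its
    own. *)
Lemma bigcell_coord_ind (P : {freeg G / k} -> Prop) :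
    P 0 -> (forall a u x, U u -> P x -> P (a *: << u >> + x)) ->
  forall v, P (Lam v).
Proof.
move=> P0 PD; elim/tr_gen_ind=> [|a g x IHx]; first by rewrite linear0.
rewrite linearP bigcell_coordE; case: asboolP => [/bigcellP [u [b [Uu Bb ->]]]|_].
  by rewrite bigcell_UE//; exact: PD.
by rewrite /= scaler0 add0r.
Qed.

Definition orbit_steinberg : {linear {freeg G / k} -> M} :=
  free_lift (fun g => rep_act M g e).
Local Notation E := orbit_steinberg.
Local Notation eps := ((-1) ^+ len w0 : k).

(** Among the terms of [u e] only the one of [w0] lies in the big cell, whence the sign. So on [kU],
    up to [eps], the map [Lam] is a left inverse of [x -> x e]. *)
Lemma bigcell_coord_U u : U u -> Lam (rep_act M u e) = eps *: << u >>.
Proof.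
move=> Uu; have Dfin := finite_Weyl bn.
have Dw0 : cosets N T (lcoset w0 T) by exists w0; first exact: Nw0.
rewrite /steinberg_vec !linear_fsum// (fsbigD1 (lcoset w0 T))//=.
rewrite !linearZ /= coset_1trE; last exact: Nw0.
rewrite tr_gen_act bigcell_coordE asboolT; last first.
  exact: (dcosetMl bn (UB Uu) (dcoset_refl bn _)).
rewrite -[(u * w0)%g]mulg1 bigcell_UE//; last exact: B1.
rewrite fsbig1 ?addr0// => _ [[n Nn <-] /= nw0].
rewrite !linearZ /= coset_1trE// tr_gen_act bigcell_coordE asboolF ?scaler0// => un.
apply: nw0; have /(dcosetMl bn (BV (UB Uu))) := un; rewrite mulKg.
move=> /(dcoset_inj bn Nw0 Nn) Tn; apply/seteqP; split=> _ [t Tt <-].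
  by exists (w0^-1 * n * t)%g; rewrite ?groupE//; exact: (TM bn).
exists ((w0^-1 * n)^-1 * t)%g; last by rewrite !groupE.
exact: (TM bn (TV Tn)).
Qed.

Lemma orbit_steinberg_lspan v : lspan gens (E (Lam v)).
Proof.
have [X0 XZ] := lspan_is_submod gens.
apply: (bigcell_coord_ind (P := fun x => lspan gens (E x))) => [|a u x Uu IHx].
  by rewrite linear0.
rewrite linearP; apply: XZ => //; apply: sub_lspan.
by rewrite /= free_liftU; exists u.
Qed.

Lemma coset_coef_bigcell u v : U u -> coset_coef [set (u * w0)%g] v = coeff u (Lam v).
Proof.
move=> Uu; elim/tr_gen_ind: v => [|a g x IHx]; first by rewrite !linear0 coeff0.
rewrite !linearP /= coeffD coeffZ IHx (coset_coefE _ (bn_B bn).1) bigcell_coordE.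
congr (_ * _ + _); case: (asboolP (dcoset w0 g)) => [/bigcellP [u' [b [Uu' Bb ->]]]|ng].
  rewrite bigcell_UE// coeffU mul1r; congr (_ _)%:R.
  apply/asboolP/eqP => [[c Bc /= cE]|->]; last first.
    by exists (b^-1)%g; rewrite /= ?mulgK//; exact: BV.
  have E1 : (u * w0 * 1 = u' * w0 * (b * c))%g by rewrite mulg1 -cE !mulgA.
  by rewrite -(bigcell_UE Uu B1) E1 bigcell_UE//; exact: BM.
rewrite coeff0 asboolF// => -[b Bb /= gE]; apply: ng.
rewrite -[g](mulgK b) gE; apply: (dcosetMr bn (BV Bb)).
exact: (dcosetMl bn (UB Uu) (dcoset_refl bn _)).
Qed.

(** The union [g P_s] of [g B] and [g B s B] is disjoint because [s] is not in [B]. *)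
Lemma coset_coef_pcoset g s v : simple s ->
  coset_coef (pcoset g s) v =
  coset_coef [set g] v + coset_coef [set h | dcoset s (g^-1 * h)%g] v.
Proof.
move=> sS; elim/tr_gen_ind: v => [|a h x IHx]; first by rewrite !linear0 addr0.
rewrite !linearP IHx !(coset_coefE _ (bn_B bn).1) addrACA; congr (_ + _).
rewrite -scalerDr -natrD; congr (_ *: _%:R).
have -> : `[< satur B [set g] h >] = `[< B (g^-1 * h)%g >].
  apply/asboolP/asboolP => [[b Bb /= <-]|Bgh].
    by rewrite invgM mulgVK; exact: BV.
  by exists (g^-1 * h)^-1%g; [exact: BV|rewrite /= !groupE].
have -> : `[< satur B [set h | dcoset s (g^-1 * h)%g] h >] = `[< dcoset s (g^-1 * h)%g >].
  apply/asboolP/asboolP => [[b Bb /= ]|sgh].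
    by rewrite mulgA => /(dcosetMr bn (BV Bb)); rewrite mulgK.
  by exists 1%g; rewrite /= ?mulg1//; exact: B1.
have [[Bgh|sgh]|ngh] := pselect (pcoset g s h).
- rewrite (asboolT Bgh) asboolT ?asboolF//; last by apply/satur_pcoset; left.
  move=> [c [c' [Bc Bc' E]]]; apply: (simple_notT bn sS); split; last exact: simple_N.
  have -> : (s = c^-1 * (g^-1 * h) * c'^-1)%g by rewrite E !groupE.
  by apply: (BM _ (BV Bc')); apply: BM => //; exact: BV.
- rewrite (asboolT sgh) asboolT ?asboolF//; last by apply/satur_pcoset; right.
  move=> Bgh; case: sgh => [c [c' [Bc Bc' E]]]; apply: (simple_notT bn sS).
  split; last exact: simple_N.
  have -> : (s = c^-1 * (g^-1 * h) * c'^-1)%g by rewrite E !groupE.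
  by apply: (BM _ (BV Bc')); apply: BM => //; exact: BV.
- by rewrite !asboolF// => [H|H|/satur_pcoset//]; apply: ngh; [right|left].
Qed.

(* A coefficient on the cell of n is, up to coefficients on the larger cell of
   n s, a coefficient on G / P_s; so v vanishes on all cells once it vanishes
   on the big one. *)
Lemma in_St_eq0 v : in_St v -> Lam v = 0 -> v = 0.
Proof.
move=> v0 Lv; apply: (coset_coef_eq0 (Bgrp := (bn_B bn).1)) => h.
have [n Nn nh] := Bruhat bn h; move: n Nn h nh.
apply: (ascent_ind bn w0top) => [n Nn Tn h nh|n s Nn sS ns IHn h nh].
  have /bigcellP [u [b [Uu Bb ->]]] : dcoset w0 h.
    apply: (dcoset_trans bn _ nh); rewrite -[n](mulVKg w0).
    exact: (dcosetMr bn (TB Tn) (dcoset_refl bn _)).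
  by rewrite coset_coef_set1M// coset_coef_bigcell// Lv coeff0.
have := coset_coef_pcoset h v sS; rewrite v0// => /esym; rewrite [X in _ + X]coset_coef_eq0_sub.
  by rewrite addr0.
move=> x; case=> b Bb /= [d [d' [Bd Bd' E]]]; apply: IHn.
case: nh => c [c' [Bc Bc' hE]].
have -> : (x = c * (n * (c' * d) * s) * (d' * b^-1))%g.
  have -> : (c * (n * (c' * d) * s) * (d' * b^-1) = c * n * c' * (d * s * d') * b^-1)%g.
    by rewrite !mulgA.
  by rewrite -hE -E !groupE.
apply: (dcosetM bn) => //; first by apply: BM => //; exact: BV.
by have /(cell_upP bn Nn sS) := ns; apply; exact: BM.
Qed.

Lemma lspan_in_St : lspan gens `<=` in_St.
Proof.
apply: lspan_sub in_St_submod _ => _ [u Uu <-].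
exact/in_St_act/steinberg_in_St.
Qed.

Lemma bigcell_coordK v : Lam (E (Lam v)) = eps *: Lam v.
Proof.
apply: (bigcell_coord_ind (P := fun x => Lam (E x) = eps *: x)) => [|a u x Uu IHx].
  by rewrite !linear0.
rewrite !linearP IHx /= free_liftU bigcell_coord_U//.
Qed.

(** The difference of the two sides lies in [in_St] and is killed by [Lam], since [eps] squares to
    1. Hence [in_St] is exactly [kU e], with [eps *: Lam v] as the coordinate of [v]. *)
Lemma in_StE v : in_St v -> v = eps *: E (Lam v).
Proof.
move=> v0; apply/eqP; rewrite -subr_eq0; apply/eqP; apply: in_St_eq0.
  have [_ XZ] := in_St_submod.
  rewrite addrC -scaleNr; apply: XZ => //; apply: lspan_in_St.
  exact: orbit_steinberg_lspan.
by rewrite linearB linearZ /= bigcell_coordK scalerA -expr2 sqrr_sign scale1r subrr.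
Qed.

Lemma in_St_lspan : in_St `<=` lspan gens.
Proof.
move=> v /in_StE ->; have [X0 XZ] := lspan_is_submod gens.
by rewrite -[X in lspan _ X]addr0; apply: XZ => //; exact: orbit_steinberg_lspan.
Qed.

Lemma St_is_stable : St_stable k B N U S.
Proof. by move=> g v /lspan_in_St /(in_St_act g); exact: in_St_lspan. Qed.

End Steinberg.

(** * The isomorphism *)

Lemma ind_tensZ (k : fieldType) (gT : groupType) (H : set gT) (V : rep k H) g a (v : V) :
  ind_tens g (a *: v) = a *: ind_tens g v.
Proof. exact: tensZr. Qed.

Lemma ind_tens_act (k : fieldType) (gT : groupType) (H : set gT) (V : rep k H) g h (v : V) :
  rep_act (Ind V) g (ind_tens h v) = ind_tens (g * h)%g v.
Proof. by rewrite /ind_tens [LHS]ind_actE /= free_mapU. Qed.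

Lemma Tpart_U (gT : groupType) (B T U : set gT) (BTU : semidirect B T U) u :
  U u -> Tpart T U u = 1%g.
Proof.
by move=> Uu; apply: (Tpart_eq BTU); rewrite ?invg1 ?mul1g//; case: BTU => -[].
Qed.

Lemma Tpart_T (gT : groupType) (B T U : set gT) (BTU : semidirect B T U) t :
  T t -> Tpart T U t = t.
Proof.
by move=> Tt; apply: (Tpart_eq BTU) => //; rewrite mulVg; case: BTU => _ [[]].
Qed.

Section TensorSteinberg.
Variables (K : closedFieldType) (G : alg_group K).
Variables (B N U : set G) (S : set (set G)).
Hypothesis bn : split_BN_pair B N U S.
Variables (k : fieldType) (theta : lin_char k (B `&` N)).
Variable w0 : G.
Hypothesis w0top : top_elt B N S w0.

Local Notation T := (B `&` N).
Local Notation BTU := (bn_B_semidirect bn).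
Local Notation M := (M_tr k B).
Local Notation Mth := (M_ind bn theta).
Local Notation Ith := (Ind (char_rep theta)).
Local Notation e := (steinberg_vec k B N S).
Local Notation StG := (St (@St_is_stable K G B N U S bn k w0 w0top)).
Local Notation tp := (Tpart T U).

(** [T] fixes each [w 1_tr], being normalised by [N] and contained in [B]. *)
Lemma steinberg_vec_T t : T t -> rep_act M t e = e.
Proof.
move=> Tt; have Dfin := finite_Weyl bn.
rewrite /steinberg_vec linear_fsum//; apply: eq_fsbigr => w.
rewrite inE => -[n Nn <-]; rewrite linearZ /= (coset_1trE bn)//; congr (_ *: _).
rewrite [LHS]tr_gen_act; have -> : (t * n = n * (n^-1 * t * n))%g by rewrite !groupE.
by apply: tr_genM; case: (TJV bn Nn Tt).
Qed.

(** * The two mutually inverse maps *)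

Definition theta_gen (g : G) : Mth :=
  ind_tens (V := infl BTU (char_rep theta)) g (1 : k^o).

Lemma theta_genM g b : B b -> theta_gen (g * b)%g = theta (tp b) *: theta_gen g.
Proof.
by move=> Bb; rewrite /theta_gen ind_tensM// -ind_tensZ.
Qed.

Definition torus_gen (g : G) : Ith := ind_tens (V := char_rep theta) g (1 : k^o).

Lemma torus_genM g t : T t -> torus_gen (g * t)%g = theta t *: torus_gen g.
Proof.
by move=> Tt; rewrite /torus_gen ind_tensM// -ind_tensZ.
Qed.

Lemma steinberg_vec_lspan : e \in in_lspan (@steinberg_gens k K G B N U S).
Proof. by apply/in_lspanP; apply: (in_St_lspan w0top); exact: steinberg_in_St. Qed.

Definition steinberg_elt : StG := Sub e steinberg_vec_lspan.

Lemma steinberg_elt_T t : T t -> rep_act StG t steinberg_elt = steinberg_elt.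
Proof. by move=> Tt; apply/val_inj; rewrite /= steinberg_vec_T. Qed.

(** Well defined over [T]: replacing [g] by [g t] multiplies the first factor by [theta t] and
    leaves the second unchanged, as [t] fixes [e]. *)
Lemma ind_to_tensor_ex : exists L : {linear Ith -> tensor_rep Mth StG},
  forall g, L (torus_gen g) = tens set0 (theta_gen g) (rep_act StG g steinberg_elt).
Proof.
have [g a u v|g t v Tt|L LE] := @ind_lift k G T (char_rep theta) (tensor_rep Mth StG)
  (fun g v => (v : k) *: tens set0 (theta_gen g) (rep_act StG g steinberg_elt)).
- by rewrite scalerDl scalerA.
- rewrite theta_genM ?(Tpart_T BTU)//; last exact: TB Tt.
  rewrite rep_actM// steinberg_elt_T//.
  by rewrite tensZl scalerA mulrC.
- by exists L => g; rewrite LE scale1r.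
Qed.

Local Notation Lam := (bigcell_coord bn k w0top).
Local Notation E := (orbit_steinberg B N S k).
Local Notation eps := ((-1) ^+ len B N S w0 : k).
Local Notation J := (free_lift torus_gen).

(** This makes the inverse map balanced over [B]. For [u] in [U] write [b^-1 u = u' t]; then
    [b^-1 u e = u' e], while [g b u' = g u t^-1] and [t^-1] is the [T]-part of [b], which yields the
    factor [theta (tp b)]. *)
Lemma torus_gen_orbit g b v : B b ->
  J (grp_lmul k (g * b)%g (Lam (rep_act M b^-1%g (E (Lam v))))) =
  eps *: (theta (tp b) *: J (grp_lmul k g (Lam v))).
Proof.
move=> Bb.
pose L1 : {linear {freeg G / k} -> Ith} :=
  (J \o grp_lmul k (g * b)%g \o Lam \o rep_act M b^-1%g \o E)%FUN.
pose L2 : {linear {freeg G / k} -> Ith} := (J \o grp_lmul k g)%FUN.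
rewrite -[LHS]/(L1 (Lam v)) -[J _ in RHS]/(L2 (Lam v)).
apply: (@bigcell_coord_ind K G B N U S bn k w0 w0top (fun x =>
  L1 x = eps *: (theta (tp b) *: L2 x))) => [|a u x Uu IHx].
  by rewrite !linear0.
suff L1u : L1 << u >> = eps *: (theta (tp b) *: L2 << u >>).
  rewrite (linearP L1) (linearP L2) IHx L1u !scalerDr !scalerA.
  by congr (_ *: _ + _); rewrite -!mulrA mulrC -mulrA.
rewrite -[L1 _]/(J (grp_lmul k (g * b)%g (Lam (rep_act M b^-1%g (E << u >>))))).
rewrite -[L2 _]/(J (grp_lmul k g << u >>)).
have [u' [t [Uu' Tt buE]]] := BUT bn (BM bn (BV bn Bb) (UB bn Uu)).
have uE : (b = u * t^-1 * u'^-1)%g.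
  have -> : (u * t^-1 * u'^-1 = u * (u' * t)^-1)%g by rewrite !groupE.
  by rewrite -buE !groupE.
have TtV := TV bn Tt; have Uu'V := UV bn Uu'.
have -> : tp b = (t^-1)%g.
  have Bu := UB bn Uu; have Bu'V := UB bn Uu'V; have BtV := TB TtV.
  have BuV := BM bn Bu BtV.
  by rewrite uE !(TpartM BTU)// (Tpart_U BTU Uu) (Tpart_U BTU Uu'V) (Tpart_T BTU TtV) mul1g mulg1.
rewrite [E _]free_liftU -rep_actM// buE rep_actM// steinberg_vec_T//.
rewrite bigcell_coord_U// !linearZ /= !free_mapU !free_liftU.
have -> : (g * b * u' = g * u * t^-1)%g by rewrite uE !groupE.
rewrite torus_genM// !scalerA; congr (_ *: _).
exact: mulrC.
Qed.

Lemma torus_gen_bigcell g b v : B b -> in_St bn v ->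
  J (grp_lmul k (g * b)%g (Lam (rep_act M b^-1%g v))) =
  theta (tp b) *: J (grp_lmul k g (Lam v)).
Proof.
move=> Bb /(in_StE w0top) vE; rewrite {1}vE !linearZ /= torus_gen_orbit//.
by rewrite [LHS]scalerA -[_ * _]expr2 sqrr_sign scale1r.
Qed.

(** By [in_StE], [v = g x e] with [x = eps *: Lam (g^-1 v)] in [kU]. As [U] acts trivially on
    [k_theta], the tensor of [g] and [g x e] must come from [g x]. *)
Lemma tensor_to_ind_ex : exists L : {linear tensor_rep Mth StG -> Ith},
  forall g a v, L (tens set0 (ind_tens g a) v) =
    (a : k) *: (eps *: J (grp_lmul k g (Lam (rep_act M g^-1%g (val v))))).
Proof.
(* For fixed [v] this is a map out of an induced module; linearity in [v] is then checked on
   generators. *)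
have lift v : exists L : {linear Mth -> Ith}, forall g a, L (ind_tens g a) =
    (a : k) *: (eps *: J (grp_lmul k g (Lam (rep_act M g^-1%g (val (v : StG)))))).
  apply: ind_lift => [g a b c|g b a Bb].
    by rewrite scalerDl; congr (_ + _); rewrite [RHS]scalerA.
  have vSt : in_St bn (rep_act M g^-1%g (val v)).
    by apply/in_St_act/(lspan_in_St bn)/in_lspanP; exact: (valP v).
  rewrite invgM rep_actM// torus_gen_bigcell//.
  set Y := J _; change ((a : k) *: (eps *: (theta (tp b) *: Y)) =
    (theta (tp b) * (a : k)) *: (eps *: Y)).
  by rewrite !scalerA; congr (_ *: _); rewrite mulrC mulrA.
have [beta betaE] := choice lift.
have [w|x|//|L LE] := @tensor_lift _ _ _ set0 Ith (fun x v => beta v x).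
- by move=> a x y; rewrite linearP.
- move=> a v w; elim/Ind_ind: x => [|b g c x IHx]; first by rewrite !linear0 addr0.
  have gc : beta (a *: v + w) (ind_tens g c) =
      a *: beta v (ind_tens g c) + beta w (ind_tens g c).
    pose L : {linear M -> Ith} := (J \o grp_lmul k g \o Lam \o rep_act M g^-1%g)%FUN.
    rewrite !betaE -![J _]/(L _) (linearP val) (linearP L) !scalerDr !scalerA.
    by congr (_ *: _ + _); rewrite -!mulrA [RHS]mulrC -!mulrA.
  rewrite !linearP /= IHx gc !scalerDr !scalerA [b * a]mulrC.
  by rewrite addrACA.
- by exists L => g a v; rewrite LE betaE.
Qed.

Lemma ind_tens_theta_gen g (a : k^o) :
  ind_tens (V := infl BTU (char_rep theta)) g a = (a : k) *: theta_gen g.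
Proof. by rewrite /theta_gen -ind_tensZ; congr ind_tens; exact/esym/mulr1. Qed.

Lemma ind_tens_torus_gen g (a : k^o) :
  ind_tens (V := char_rep theta) g a = (a : k) *: torus_gen g.
Proof. by rewrite /torus_gen -ind_tensZ; congr ind_tens; exact/esym/mulr1. Qed.

Definition orbit_steinberg_elt : {linear {freeg G / k} -> StG} :=
  free_lift (fun g => rep_act StG g steinberg_elt).
Local Notation ESt := orbit_steinberg_elt.

Lemma val_orbit_steinberg_elt x : val (ESt x) = E x.
Proof.
pose L : {linear {freeg G / k} -> M} := (val \o ESt)%FUN.
rewrite -[LHS]/(L x); elim/freeg_ind: x => [|a g x IHx]; first by rewrite !linear0.
by rewrite (linearP L) (linearP E) IHx; congr (_ *: _ + _); rewrite /L /= !free_liftU.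
Qed.

Lemma St_eltE (v : StG) : v = eps *: ESt (Lam (val v)).
Proof.
apply/val_inj; rewrite linearZ /= val_orbit_steinberg_elt.
by apply: (in_StE (bn := bn)); apply/(lspan_in_St bn)/in_lspanP; exact: (valP v).
Qed.

(** For [u] in [U] one has [theta_gen (g * u) = theta_gen g], so only the Steinberg factor sees the
    element of [kU]. *)
Lemma ind_to_tensor_orbit (Phi : {linear Ith -> tensor_rep Mth StG}) g v :
    (forall g, Phi (torus_gen g) = tens set0 (theta_gen g) (rep_act StG g steinberg_elt)) ->
  Phi (J (grp_lmul k g (Lam v))) = tens set0 (theta_gen g) (rep_act StG g (ESt (Lam v))).
Proof.
move=> PhiE; pose L : {linear _ -> _} := (Phi \o J \o grp_lmul k g)%FUN.
apply: (@bigcell_coord_ind K G B N U S bn k w0 w0top (fun x =>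
  L x = tens set0 (theta_gen g) (rep_act StG g (ESt x)))) => [|a u x Uu IHx].
  by rewrite (linear0 L) (linear0 ESt) linear0 tens0r.
rewrite (linearP L) (linearP ESt) (linearP (rep_act StG g)) tens_linr IHx.
congr (_ *: _ + _); rewrite -[LHS]/(Phi (J (grp_lmul k g << u >>))).
rewrite [grp_lmul _ _ _]free_mapU [J _]free_liftU [ESt _]free_liftU PhiE.
rewrite theta_genM; last exact: (UB bn).
by rewrite (Tpart_U BTU Uu) char1 scale1r -rep_actM.
Qed.

Lemma tensor_to_indK (Phi : {linear Ith -> tensor_rep Mth StG})
    (Psi : {linear tensor_rep Mth StG -> Ith}) :
    (forall g, Phi (torus_gen g) = tens set0 (theta_gen g) (rep_act StG g steinberg_elt)) ->
    (forall g a v, Psi (tens set0 (ind_tens g a) v) =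
      (a : k) *: (eps *: J (grp_lmul k g (Lam (rep_act M g^-1%g (val v)))))) ->
  cancel Psi Phi /\ cancel Phi Psi.
Proof.
move=> PhiE PsiE; split.
  elim/tensor_ind=> [|a x v y IHy]; first by rewrite !linear0.
  rewrite (linearP Psi) (linearP Phi) IHy; congr (_ *: _ + _).
  elim/Ind_ind: x => [|b g c x IHx].
    by rewrite tens0l (linear0 Psi) (linear0 Phi).
  rewrite tens_linl (linearP Psi) (linearP Phi) IHx; congr (_ *: _ + _).
  rewrite PsiE !(linearZ_LR Phi) /= ind_to_tensor_orbit// ind_tens_theta_gen.
  rewrite tensZl; congr (_ *: _).
  (* The second tensor factor is expanded by [St_eltE] after translation by [g^-1], to match the
     image of [Phi]. *)
  have {2}-> : v = rep_act StG g (eps *: ESt (Lam (rep_act M g^-1%g (val v)))).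
    rewrite -[rep_act M _ _]/(val (rep_act StG g^-1%g v)) -St_eltE.
    by rewrite -rep_actM// mulgV rep_act1.
  by rewrite (linearZ_LR (rep_act StG g)) tensZr.
elim/Ind_ind=> [|a g c x IHx]; first by rewrite !linear0.
rewrite (linearP Phi) (linearP Psi) IHx; congr (_ *: _ + _).
rewrite ind_tens_torus_gen (linearZ_LR Phi) (linearZ_LR Psi) /= PhiE /theta_gen PsiE; congr (_ *: _).
(* The second factor is [g e], so translation by [g^-1] leaves [e], whose coordinate is [eps] times
   the unit; the two signs cancel. *)
rewrite -[val _]/(rep_act M g e) -rep_actM// mulVg bigcell_coord_U; last exact: (U1 bn).
rewrite [LHS]scale1r (linearZ_LR (grp_lmul k g)) (linearZ_LR J).
rewrite [grp_lmul _ _ _]free_mapU /= free_liftU mulg1.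
by rewrite [LHS]scalerA -[_ * _]expr2 sqrr_sign scale1r.
Qed.

Lemma ind_to_tensor_act (Phi : {linear Ith -> tensor_rep Mth StG}) g x :
    (forall g, Phi (torus_gen g) = tens set0 (theta_gen g) (rep_act StG g steinberg_elt)) ->
  Phi (rep_act Ith g x) = rep_act (tensor_rep Mth StG) g (Phi x).
Proof.
move=> PhiE; elim/Ind_ind: x => [|a h c x IHx]; first by rewrite !linear0.
rewrite !(linearP Phi, linearP (rep_act _ _)) IHx; congr (_ *: _ + _).
rewrite ind_tens_act !ind_tens_torus_gen !(linearZ_LR Phi) (linearZ_LR (rep_act _ _)) /= !PhiE.
congr (_ *: _).
apply/esym/(etrans (tensor_actE (V := Mth) (W := StG) g _ _)).
by rewrite -rep_actM// /theta_gen ind_tens_act.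
Qed.

End TensorSteinberg.

Theorem proposition2p4 (K : closedFieldType) (G : alg_group K)
    (B N U : set G) (S : set (set G)) (bn : split_BN_pair B N U S)
    (k : fieldType) (theta : lin_char k (B `&` N)) :
  exists St_sub : St_stable k B N U S,
    rep_iso (tensor_rep (M_ind bn theta) (St St_sub)) (Ind (char_rep theta)).
Proof.
have [w0 w0top] := top_elt_ex bn.
exists (@St_is_stable K G B N U S bn k w0 w0top).
have [Phi PhiE] := ind_to_tensor_ex bn theta w0top.
have [Psi PsiE] := tensor_to_ind_ex bn theta w0top.
have [PsiK PhiK] := tensor_to_indK PhiE PsiE.
exists Psi; split=> [|g x _]; first by exists Phi.
(* Equivariance is known for [Phi], whose generators are simpler to act on, and passes to its
   inverse [Psi]. *)
by rewrite -{1}[x]PsiK -ind_to_tensor_act.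
Qed.
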